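(* Let $\mathcal{K}$ be a cartesian closed $\infty$-cosmos, let $\lambda\colon fh\Rightarrow gk$ be a comma square, with $f\colon B\to A$, $g\colon C\to A$, $D=f\downarrow g$, and projections $h\colon D\to B$ and $k\colon D\to C$, and let $E$ be any object of $\mathcal{K}$. Write $f^*=E^f\colon E^A\to E^B$ and similarly for $g,h,k$, and let $\lambda^*\colon h^*f^*\Rightarrow k^*g^*\colon E^A\to E^D$ be the 2-cell induced by $\lambda$. Then the Beck–Chevalley condition is satisfied for $\lambda^*$ whenever functorial pointwise left or right Kan extensions of these functors exist, i.e. the mates of $\lambda^*$ are isomorphisms: if $E$ admits functorial pointwise right Kan extension along $g$ and $h$, then the mate $\lambda^!\colon f^*\,\mathrm{ran}_g\Rightarrow\mathrm{ran}_h\,k^*\colon E^C\to E^B$ is an isomorphism; and if $E$ admits functorial pointwise left Kan extension along $f$ and $k$, then the mate $\lambda_!\colon\mathrm{lan}_k\,h^*\Rightarrow g^*\,\mathrm{lan}_f\colon E^B\to E^C$ is an isomorphism.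
   Context: An $\infty$-cosmos (with all objects cofibrant) is a simplicially enriched category $\mathcal{K}$ whose mapping spaces $\mathrm{map}(A,B)$ are quasi-categories, equipped with a subcategory of isofibrations (written $\twoheadrightarrow$), such that: (a) $\mathcal{K}$ has, in the simplicially enriched sense, a terminal object $1$, cotensors $U\pitchfork A$ of every object $A$ by every finitely presented simplicial set $U$, and pullbacks of isofibrations along arbitrary morphisms (''simplicial pullbacks''); (b) isofibrations include all isomorphisms and all maps $A\to 1$, are stable under pullback, for every isofibration $p\colon E\twoheadrightarrow B$ and inclusion $U\hookrightarrow V$ of finitely presented simplicial sets the induced map $V\pitchfork E\to (U\pitchfork E)\times_{U\pitchfork B}(V\pitchfork B)$ is an isofibration, and $\mathrm{map}(X,p)$ is an isofibration of quasi-categories for every object $X$; (c) every object has the left lifting property with respect to trivial fibrations. Here $f$ is an equivalence if $\mathrm{map}(X,f)$ is an equivalence of quasi-categories for all $X$, and a trivial fibration if it is an isofibration and an equivalence. Objects of $\mathcal{K}$ are called $\infty$-categories and its morphisms functors. The homotopy 2-category $\mathcal{K}_2$ has the same objects and 1-cells, with $\hom(A,B)$ the homotopy category of $\mathrm{map}(A,B)$; 2-cells are those of $\mathcal{K}_2$. $\mathcal{K}$ is cartesian closed if the binary product extends to a simplicially enriched two-variable adjunction $\mathrm{map}(A\times B,C)\cong\mathrm{map}(A,C^B)\cong\mathrm{map}(B,C^A)$; then $\mathcal{K}_2$ is a cartesian closed 2-category, and $E^{(-)}$ acts on functors and 2-cells by precomposition. Comma squares. For functors $f\colon B\to A$, $g\colon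 C\to A$, the comma $\infty$-category $f\downarrow g$ is the simplicial pullback of $(p_1,p_0)\colon\Delta^1\pitchfork A\twoheadrightarrow A\times A$ (evaluation at $1$ and $0$) along $g\times f\colon C\times B\to A\times A$, with projections $p_1\colon f\downarrow g\to C$, $p_0\colon f\downarrow g\to B$ and canonical 2-cell $\phi\colon fp_0\Rightarrow gp_1$ in $\mathcal{K}_2$; this square is called a comma square. Pointwise Kan extensions. In a 2-category, $\mu\colon rk\Rightarrow f$ (with $k\colon A\to B$, $f\colon A\to C$, $r\colon B\to C$) is a right extension of $f$ along $k$ if for every $e\colon B\to C$ the map sending $\beta\colon e\Rightarrow r$ to $\mu\cdot\beta k\colon ek\Rightarrow f$ is a bijection. It is stable under pasting with a square $\lambda\colon bh\Rightarrow kg$ (with $h\colon D\to E$, $g\colon D\to A$, $b\colon E\to B$) if $\mu g\cdot r\lambda\colon rbh\Rightarrow fg$ displays $rb$ as a right extension of $fg$ along $h$. A pointwise right Kan extension is a right extension in $\mathcal{K}_2$ that is stable under pasting with all comma squares. Pointwise left Kan extensions are the dual notion: pointwise right Kan extensions in the dual $\infty$-cosmos obtained by replacing every mapping quasi-category by its opposite (whose homotopy 2-category is $\mathcal{K}_2$ with 2-cells reversed). $E$ admits functorial pointwise right Kan extension along $k\colon A\to B$ if there is a pointwise right Kan extension $\nu\colon\mathrm{ran}_k(-)\circ(k\times E^A)\Rightarrow\mathrm{ev}$ of the evaluation functor $\mathrm{ev}\colon A\times E^A\to E$ along $k\times E^A\colon A\times E^A\to B\times E^A$. Its transpose $\mathrm{ran}_k\colon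 E^A\to E^B$ is right adjoint to $k^*=E^k$ with counit the transpose $k^*\,\mathrm{ran}_k\Rightarrow\mathrm{id}$ of $\nu$. Dually, a functorial pointwise left Kan extension along $k$ yields a left adjoint $\mathrm{lan}_k\colon E^A\to E^B$ of $k^*$. The mate $\lambda^!$ is the composite $f^*\mathrm{ran}_g\Rightarrow\mathrm{ran}_hh^*f^*\mathrm{ran}_g\Rightarrow\mathrm{ran}_hk^*g^*\mathrm{ran}_g\Rightarrow\mathrm{ran}_hk^*$ of a unit, $\lambda^*$ and a counit; $\lambda_!$ is the composite $\mathrm{lan}_kh^*\Rightarrow\mathrm{lan}_kh^*f^*\mathrm{lan}_f\Rightarrow\mathrm{lan}_kk^*g^*\mathrm{lan}_f\Rightarrow g^*\mathrm{lan}_f$. *)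

(* Defs.v *)
(* Written over MathComp, with classical logic from mathcomp.classical.boolp. *)
From mathcomp Require Import all_boot.
From mathcomp Require Import boolp zify.

Set Implicit Arguments.
Unset Strict Implicit.
Unset Printing Implicit Defensive.

(** * Simplicial sets *)

(* [mono m n] is the hom-set Delta([m],[n]). *)
Record mono (m n : nat) := Mono {
  mono_fun :> {ffun 'I_m.+1 -> 'I_n.+1};
  mono_homo : [forall i : 'I_m.+1, forall j : 'I_m.+1,
                (i <= j) ==> (mono_fun i <= mono_fun j)] }.

Lemma mono_le m n (a : mono m n) (i j : 'I_m.+1) : i <= j -> a i <= a j.
Proof. by move: (mono_homo a) => /forallP/(_ i)/forallP/(_ j)/implyP. Qed.

Lemma mono_ext m n (a b : mono m n) : (forall i, a i = b i) -> a = b.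
Proof.
case: a b => [f Hf] [g Hg] /= fg.
have e : f = g by apply/ffunP.
by case: g / e Hg {fg} => Hg; congr Mono; apply: bool_irrelevance.
Qed.

Definition mk_mono m n (f : 'I_m.+1 -> 'I_n.+1)
  (H : forall i j : 'I_m.+1, i <= j -> f i <= f j) : mono m n.
Proof.
by exists [ffun i => f i]; apply/forallP=> i; apply/forallP=> j;
  apply/implyP=> ij; rewrite !ffunE; apply: H.
Defined.

Lemma mk_monoE m n f H i : @mk_mono m n f H i = f i.
Proof. by rewrite /= ffunE. Qed.

Definition mono_id n : mono n n := mk_mono (f := id) (fun i j H => H).

Definition mono_comp l m n (b : mono m n) (a : mono l m) : mono l n :=
  mk_mono (f := fun i => b (a i)) (fun i j H => mono_le b (mono_le a H)).

Definition mono_const m n (k : 'I_n.+1) : mono m n :=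
  mk_mono (f := fun _ => k) (fun _ _ _ => leqnn k).

Lemma coface_homo n (k : 'I_n.+2) (i j : 'I_n.+1) :
  i <= j -> lift k i <= lift k j.
Proof. by rewrite /= leq_bump2. Qed.

(* The elementary face operator whose image omits [k]. *)
Definition coface n (k : 'I_n.+2) : mono n n.+1 := mk_mono (@coface_homo n k).

Lemma rev_homo m n (a : mono m n) (i j : 'I_m.+1) :
  i <= j -> rev_ord (a (rev_ord i)) <= rev_ord (a (rev_ord j)).
Proof. by move=> ij; rewrite /= leq_sub2l // ltnS; apply: mono_le; rewrite /= leq_sub2l. Qed.

(* The action on arrows of the order-reversing involution of Delta. *)
Definition mono_rev m n (a : mono m n) : mono m n := mk_mono (rev_homo a).

Lemma mono_compE l m n (b : mono m n) (a : mono l m) i :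
  mono_comp b a i = b (a i).
Proof. exact: mk_monoE. Qed.

Lemma mono_comp1 m n (a : mono m n) : mono_comp a (mono_id m) = a.
Proof. by apply: mono_ext => i; rewrite mono_compE mk_monoE. Qed.

Lemma mono_1comp m n (a : mono m n) : mono_comp (mono_id n) a = a.
Proof. by apply: mono_ext => i; rewrite mono_compE mk_monoE. Qed.

Lemma mono_compA k l m n (c : mono m n) (b : mono l m) (a : mono k l) :
  mono_comp c (mono_comp b a) = mono_comp (mono_comp c b) a.
Proof. by apply: mono_ext => i; rewrite !mono_compE. Qed.

Lemma mono_const_comp l m n (k : 'I_n.+1) (a : mono l m) :
  mono_comp (mono_const m k) a = mono_const l k.
Proof. by apply: mono_ext => i; rewrite mono_compE !mk_monoE. Qed.

Lemma mono_rev1 n : mono_rev (mono_id n) = mono_id n.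
Proof. by apply: mono_ext => i; rewrite !mk_monoE rev_ordK. Qed.

Lemma mono_rev_comp l m n (b : mono m n) (a : mono l m) :
  mono_rev (mono_comp b a) = mono_comp (mono_rev b) (mono_rev a).
Proof.
by apply: mono_ext => i; rewrite mono_compE !mk_monoE rev_ordK.
Qed.

Lemma mono_rev_const m n (k : 'I_n.+1) :
  mono_rev (mono_const m k) = mono_const m (rev_ord k).
Proof. by apply: mono_ext => i; rewrite !mk_monoE. Qed.

Lemma mono_rev_coface n (k : 'I_n.+2) :
  mono_rev (coface k) = coface (rev_ord k).
Proof.
apply: mono_ext => i; rewrite !mk_monoE; apply: val_inj.
by rewrite /= /bump; move: (ltn_ord i) (ltn_ord k) => /=; lia.
Qed.

Record sSet := SSet {
  simp :> nat -> Type;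
  act : forall m n, mono m n -> simp n -> simp m;
  act_id : forall n (x : simp n), act (mono_id n) x = x;
  act_comp : forall l m n (a : mono l m) (b : mono m n) (x : simp n),
    act a (act b x) = act (mono_comp b a) x }.

Record sHom (X Y : sSet) := SHom {
  sfun :> forall n, X n -> Y n;
  sfun_act : forall m n (a : mono m n) (x : X n),
    sfun (act a x) = act a (sfun x) }.

(* The degenerate [n]-simplex at a vertex. *)
Definition deg (X : sSet) n (x : X 0) : X n := act (mono_const n ord0) x.

Lemma act_deg (X : sSet) m n (a : mono m n) (x : X 0) : act a (deg n x) = deg m x.
Proof. by rewrite /deg act_comp mono_const_comp. Qed.

Lemma deg0 (X : sSet) (x : X 0) : deg 0 x = x.
Proof.
rewrite /deg; have -> : mono_const 0 ord0 = mono_id 0 :> mono 0 0.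
  by apply: mono_ext => i; rewrite !mk_monoE [i]ord1.
by rewrite act_id.
Qed.

Lemma sfun_deg (X Y : sSet) (F : sHom X Y) n (x : X 0) :
  F n (deg n x) = deg n (F 0 x).
Proof. by rewrite /deg sfun_act. Qed.

Definition shom_comp (X Y Z : sSet) (G : sHom Y Z) (F : sHom X Y) : sHom X Z.
Proof. by exists (fun n x => G n (F n x)) => m n a x; rewrite !sfun_act. Defined.

Definition Delta (k : nat) : sSet.
Proof.
exists (fun n => mono n k) (fun m n a b => mono_comp b a) => [n x|l m n a b x].
  exact: mono_comp1.
by rewrite mono_compA.
Defined.

Definition sprod (X Y : sSet) : sSet.
Proof.
exists (fun n => (X n * Y n)%type) (fun m n a x => (act a x.1, act a x.2)).
  by move=> n [x y]; rewrite /= !act_id.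
by move=> l m n a b [x y]; rewrite /= !act_comp.
Defined.

Definition sop (X : sSet) : sSet.
Proof.
exists X (fun m n a x => act (mono_rev a) x) => [n x|l m n a b x].
  by rewrite mono_rev1 act_id.
by rewrite act_comp mono_rev_comp.
Defined.

Definition in_horn (n : nat) (k : 'I_n.+1) m (a : mono m n) : bool :=
  [exists j : 'I_n.+1, (j != k) && [forall i, a i != j]].

Lemma in_horn_comp n (k : 'I_n.+1) l m (a : mono l m) (b : mono m n) :
  in_horn k b -> in_horn k (mono_comp b a).
Proof.
move=> /existsP [j /andP [jk /forallP H]]; apply/existsP; exists j.
by rewrite jk; apply/forallP => i; rewrite mono_compE.
Qed.

(* The horn Lambda^n_k. *)
Definition horn (n : nat) (k : 'I_n.+1) : sSet.
Proof.
exists (fun m => {a : mono m n | in_horn k a})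
  (fun l m a b => exist _ (mono_comp (sval b) a) (in_horn_comp a (svalP b))).
  by move=> m [b Hb]; apply: eq_exist; rewrite /= mono_comp1.
by move=> l m p a b [c Hc]; apply: eq_exist; rewrite /= mono_compA.
Defined.

Definition horn_incl n (k : 'I_n.+1) : sHom (horn k) (Delta n).
Proof. by exists (fun m b => sval b). Defined.

(* The nerve of the free-living isomorphism: the category with two objects
   and exactly one arrow between any two of them. *)
Definition Jiso : sSet.
Proof.
exists (fun n => {ffun 'I_n.+1 -> bool}) (fun m n a s => [ffun i => s (a i)]).
  by move=> n x; apply/ffunP => i; rewrite ffunE mk_monoE.
by move=> l m n a b x; apply/ffunP => i; rewrite !ffunE.
Defined.

Definition Jend (b : bool) n : Jiso n := [ffun _ : 'I_n.+1 => b].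

Definition Jpt (b : bool) : sHom (Delta 0) Jiso.
Proof.
exists (fun n _ => Jend b n).
by move=> m n a x; apply/ffunP => i; rewrite /= !ffunE.
Defined.

Definition to_point (X : sSet) : sHom X (Delta 0).
Proof.
exists (fun n _ => mono_const n ord0) => m n a x /=.
by rewrite mono_const_comp.
Defined.

Definition degenerate (X : sSet) n (x : X n) : Prop :=
  exists m (s : mono n m) (y : X m),
    [/\ m < n, (forall j, exists i, s i = j) & x = act s y].

(* A simplicial set is finitely presented iff it has only finitely many
   non-degenerate simplices. *)
Definition finitely_presented (X : sSet) : Prop :=
  exists l : seq {n : nat & X n}, forall n (x : X n),
    ~ degenerate x -> List.In (existT _ n x) l.

Definition injective_shom (U V : sSet) (i : sHom U V) : Prop :=
  forall n, injective (i n).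

(** * Quasi-categories *)

Definition has_rlp (U V X Y : sSet) (i : sHom U V) (p : sHom X Y) : Prop :=
  forall (u : sHom U X) (v : sHom V Y),
    (forall n x, p n (u n x) = v n (i n x)) ->
    exists d : sHom V X,
      (forall n x, d n (i n x) = u n x) /\ (forall n x, p n (d n x) = v n x).

Definition inner_fibration (X Y : sSet) (p : sHom X Y) : Prop :=
  forall n (k : 'I_n.+1), 0 < k < n -> has_rlp (horn_incl k) p.

Definition quasi_category (X : sSet) : Prop := inner_fibration (to_point X).

Definition qcat_isofibration (X Y : sSet) (p : sHom X Y) : Prop :=
  inner_fibration p /\ has_rlp (Jpt false) p.

Definition qcat_equivalence (X Y : sSet) (F : sHom X Y) : Prop :=
  exists G : sHom Y X,
    (exists H : sHom (sprod X Jiso) X, forall n (x : X n),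
       H n (x, Jend false n) = x /\ H n (x, Jend true n) = G n (F n x)) /\
    (exists H : sHom (sprod Y Jiso) Y, forall n (y : Y n),
       H n (y, Jend false n) = F n (G n y) /\ H n (y, Jend true n) = y).

(** * Homotopy categories *)

Lemma sig_ext (T : Type) (P : T -> Prop) (u v : {x | P x}) :
  sval u = sval v -> u = v.
Proof. by case: u v => [x Px] [y Py] /= xy; apply: eq_exist. Qed.

(* [quot R] is the quotient of [T] by [R], realised as a type of classes; it
   is only used for equivalence relations. *)
Definition quot (T : Type) (R : T -> T -> Prop) : Type :=
  {c : T -> Prop | exists x, c = R x}.

Definition qpi T (R : T -> T -> Prop) (x : T) : quot R :=
  exist _ (R x) (ex_intro _ x erefl).

Definition repr T (R : T -> T -> Prop) (c : quot R) : T := sval (cid (svalP c)).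

Lemma reprK T (R : T -> T -> Prop) (c : quot R) : qpi R (repr c) = c.
Proof. by apply: sig_ext; rewrite /repr /=; case: cid. Qed.

Definition vsrc (X : sSet) (e : X 1) : X 0 := act (coface (ord_max : 'I_2)) e.
Definition vtgt (X : sSet) (e : X 1) : X 0 := act (coface (ord0 : 'I_2)) e.

Definition edge (X : sSet) (x y : X 0) : Type :=
  {e : X 1 | vsrc e = x /\ vtgt e = y}.

Lemma deg_edge_subproof (X : sSet) (x : X 0) :
  vsrc (deg 1 x) = x /\ vtgt (deg 1 x) = x.
Proof. by rewrite /vsrc /vtgt !act_deg deg0. Qed.

Definition deg_edge (X : sSet) (x : X 0) : edge x x :=
  exist _ (deg 1 x) (deg_edge_subproof x).

(* The homotopy category of [X], in its presentation by generators and
   relations (the left adjoint of the nerve): arrows are formal composites of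
   edges modulo the category axioms and the relations given by degenerate edges
   and by 2-simplices.  Composition is written in diagrammatic order.  If [X]
   is a quasi-category every arrow is the class of a single edge, and two
   parallel edges have the same class iff they are homotopic. *)
Inductive word (X : sSet) : X 0 -> X 0 -> Type :=
| wid x : word x x
| wedge x y (e : edge x y) : word x y
| wcat x y z (p : word x y) (q : word y z) : word x z.

Inductive wrel (X : sSet) : forall x y : X 0, word x y -> word x y -> Prop :=
| wrel_refl x y (p : word x y) : wrel p p
| wrel_sym x y (p q : word x y) : wrel p q -> wrel q p
| wrel_trans x y (p q r : word x y) : wrel p q -> wrel q r -> wrel p r
| wrel_cat x y z (p p' : word x y) (q q' : word y z) :
    wrel p p' -> wrel q q' -> wrel (wcat p q) (wcat p' q')
| wrel_idl x y (p : word x y) : wrel (wcat (wid x) p) p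
| wrel_idr x y (p : word x y) : wrel (wcat p (wid y)) p
| wrel_assoc x y z t (p : word x y) (q : word y z) (r : word z t) :
    wrel (wcat p (wcat q r)) (wcat (wcat p q) r)
| wrel_deg x : wrel (wedge (deg_edge x)) (wid x)
| wrel_tri x y z (s : X 2) (e01 : edge x y) (e12 : edge y z) (e02 : edge x z) :
    sval e01 = act (coface (inord 2 : 'I_3)) s ->
    sval e12 = act (coface (inord 0 : 'I_3)) s ->
    sval e02 = act (coface (inord 1 : 'I_3)) s ->
    wrel (wcat (wedge e01) (wedge e12)) (wedge e02).

Definition harr (X : sSet) (x y : X 0) : Type := quot (@wrel X x y).

Definition hpi (X : sSet) (x y : X 0) (w : word x y) : harr x y := qpi _ w.

Lemma hpi_eq (X : sSet) (x y : X 0) (p q : word x y) :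
  wrel p q -> hpi p = hpi q.
Proof.
move=> pq; apply: sig_ext; apply/funext => r; apply/propext; split => H.
  exact: wrel_trans (wrel_sym pq) H.
exact: wrel_trans pq H.
Qed.

Lemma hpi_inj (X : sSet) (x y : X 0) (p q : word x y) :
  hpi p = hpi q -> wrel p q.
Proof. by case=> e; rewrite e; apply: wrel_refl. Qed.

Lemma repr_hpi (X : sSet) (x y : X 0) (p : word x y) : wrel (repr (hpi p)) p.
Proof. by apply: hpi_inj; rewrite /hpi reprK. Qed.

Definition hid (X : sSet) (x : X 0) : harr x x := hpi (wid x).

Definition hcomp (X : sSet) (x y z : X 0) (p : harr x y) (q : harr y z) :
  harr x z := hpi (wcat (repr p) (repr q)).

Lemma hcomp_hpi (X : sSet) (x y z : X 0) (p : word x y) (q : word y z) :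
  hcomp (hpi p) (hpi q) = hpi (wcat p q).
Proof. by apply: hpi_eq; apply: wrel_cat; apply: repr_hpi. Qed.

Definition hcast (X : sSet) (x x' y y' : X 0) (ex : x = x') (ey : y = y')
    (p : harr x y) : harr x' y' :=
  match ex in _ = u, ey in _ = v return harr u v with erefl, erefl => p end.

Lemma edge_map_subproof (X Y : sSet) (F : sHom X Y) (x y : X 0) (e : edge x y) :
  vsrc (F 1 (sval e)) = F 0 x /\ vtgt (F 1 (sval e)) = F 0 y.
Proof. by case: e => e /= [<- <-]; rewrite /vsrc /vtgt !sfun_act. Qed.

Definition edge_map (X Y : sSet) (F : sHom X Y) (x y : X 0) (e : edge x y) :
  edge (F 0 x) (F 0 y) := exist _ (F 1 (sval e)) (edge_map_subproof F e).

Fixpoint word_map (X Y : sSet) (F : sHom X Y) (x y : X 0) (w : word x y) :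
    word (F 0 x) (F 0 y) :=
  match w in word x y return word (F 0 x) (F 0 y) with
  | wid x => wid (F 0 x)
  | wedge x y e => wedge (edge_map F e)
  | wcat x y z p q => wcat (word_map F p) (word_map F q)
  end.

Lemma wrel_map (X Y : sSet) (F : sHom X Y) (x y : X 0) (p q : word x y) :
  wrel p q -> wrel (word_map F p) (word_map F q).
Proof.
elim=> {x y p q} /=.
- by move=> *; apply: wrel_refl.
- by move=> *; apply: wrel_sym.
- by move=> x y p q r _ H1 _ H2; apply: wrel_trans H1 H2.
- by move=> *; apply: wrel_cat.
- by move=> *; apply: wrel_idl.
- by move=> *; apply: wrel_idr.
- by move=> *; apply: wrel_assoc.
- move=> x; suff -> : edge_map F (deg_edge x) = deg_edge (F 0 x).
    exact: wrel_deg.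
  by apply: sig_ext; rewrite /= sfun_deg.
- move=> x y z s a b c Ha Hb Hc.
  by apply: (@wrel_tri _ _ _ _ (F 2 s)); rewrite /= ?Ha ?Hb ?Hc sfun_act.
Qed.

(* The action of a simplicial map on homotopy categories. *)
Definition hmap (X Y : sSet) (F : sHom X Y) (x y : X 0) (p : harr x y) :
  harr (F 0 x) (F 0 y) := hpi (word_map F (repr p)).

Lemma hmap_hpi (X Y : sSet) (F : sHom X Y) (x y : X 0) (p : word x y) :
  hmap F (hpi p) = hpi (word_map F p).
Proof. by apply: hpi_eq; apply: wrel_map; apply: repr_hpi. Qed.

Lemma edge_op_subproof (X : sSet) (x y : X 0) (e : edge x y) :
  @vsrc (sop X) (sval e) = y /\ @vtgt (sop X) (sval e) = x.
Proof.
case: e => e /= [<- <-]; rewrite /vsrc /vtgt /= !mono_rev_coface.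
by split; congr act; congr coface; apply: val_inj.
Qed.

Definition edge_op (X : sSet) (x y : X 0) (e : edge x y) : @edge (sop X) y x :=
  exist _ (sval e) (edge_op_subproof e).

Fixpoint word_op (X : sSet) (x y : X 0) (w : word x y) : @word (sop X) y x :=
  match w in word x y return @word (sop X) y x with
  | wid x => @wid (sop X) x
  | wedge x y e => @wedge (sop X) _ _ (edge_op e)
  | wcat x y z p q => wcat (word_op q) (word_op p)
  end.

Lemma wrel_op (X : sSet) (x y : X 0) (p q : word x y) :
  wrel p q -> wrel (word_op p) (word_op q).
Proof.
elim=> {x y p q} /=.
- by move=> *; apply: wrel_refl.
- by move=> *; apply: wrel_sym.
- by move=> x y p q r _ H1 _ H2; apply: wrel_trans H1 H2.
- by move=> *; apply: wrel_cat.
- by move=> *; apply: wrel_idr.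
- by move=> *; apply: wrel_idl.
- by move=> *; apply/wrel_sym/wrel_assoc.
- move=> x; suff -> : edge_op (deg_edge x) = @deg_edge (sop X) x.
    exact: wrel_deg.
  apply: sig_ext; rewrite /= /deg /= mono_rev_const.
  by congr act; congr mono_const; apply: val_inj.
- move=> x y z s a b c Ha Hb Hc.
  by apply: (@wrel_tri (sop X) _ _ _ s); rewrite /= ?Ha ?Hb ?Hc mono_rev_coface;
    congr act; congr coface; apply: val_inj; rewrite /= !inordK.
Qed.

(* The homotopy category of the opposite is the opposite of the homotopy
   category. *)
Definition harr_op (X : sSet) (x y : X 0) (p : harr x y) : @harr (sop X) y x :=
  hpi (word_op (repr p)).

Lemma harr_op_hpi (X : sSet) (x y : X 0) (p : word x y) :
  harr_op (hpi p) = hpi (word_op p).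
Proof. by apply: hpi_eq; apply: wrel_op; apply: repr_hpi. Qed.

(** * Simplicially enriched categories *)

Record sCat := SCat {
  ob :> Type;
  Map : ob -> ob -> sSet;
  sid : forall A, Map A A 0;
  scomp : forall A B C n, Map B C n -> Map A B n -> Map A C n;
  scomp_act : forall A B C m n (a : mono m n) (y : Map B C n) (x : Map A B n),
    act a (scomp y x) = scomp (act a y) (act a x);
  scompA : forall A B C D n (z : Map C D n) (y : Map B C n) (x : Map A B n),
    scomp z (scomp y x) = scomp (scomp z y) x;
  scomp1l : forall A B n (x : Map A B n), scomp (deg n (sid B)) x = x;
  scomp1r : forall A B n (x : Map A B n), scomp x (deg n (sid A)) = x }.

Arguments Map {K} A B : rename.
Arguments sid {K} A : rename.
Arguments scomp {K A B C n} y x : rename.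

Notation "y ∘ x" := (scomp y x) (at level 40, left associativity).

(* 1-cells are the vertices of the mapping spaces. *)
Definition fn (K : sCat) (A B : K) : Type := Map A B 0.

Definition post (K : sCat) (X A B : K) (f : fn A B) : sHom (Map X A) (Map X B).
Proof.
by exists (fun n x => deg n f ∘ x) => m n a x; rewrite scomp_act act_deg.
Defined.

Definition pre (K : sCat) (A B Y : K) (f : fn A B) : sHom (Map B Y) (Map A Y).
Proof.
by exists (fun n y => y ∘ deg n f) => m n a x; rewrite scomp_act act_deg.
Defined.

(* The dual simplicial category: opposite mapping spaces, hence reversed 2-cells. *)
Definition co (K : sCat) : sCat.
Proof.
exists (ob K) (fun A B => sop (Map A B)) (fun A => sid A)
  (fun A B C n y x => @scomp K A B C n y x).
- by move=> A B C m n a y x; rewrite /= scomp_act.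
- by move=> A B C D n z y x; apply: scompA.
- move=> A B n x; have -> : @deg (sop (Map B B)) n (sid B) = deg n (sid B).
    rewrite /deg /= mono_rev_const; congr act; congr mono_const; exact: val_inj.
  exact: scomp1l.
- move=> A B n x; have -> : @deg (sop (Map A A)) n (sid A) = deg n (sid A).
    rewrite /deg /= mono_rev_const; congr act; congr mono_const; exact: val_inj.
  exact: scomp1r.
Defined.

(** ** Simplicially enriched limits *)

Definition is_terminal (K : sCat) (T : K) : Prop :=
  forall (X : K) n, exists! x : Map X T n, True.

Definition is_product (K : sCat) (A B P : K) (p : fn P A) (q : fn P B) : Prop :=
  forall (X : K) n (a : Map X A n) (b : Map X B n),
    exists! c : Map X P n, deg n p ∘ c = a /\ deg n q ∘ c = b.

Definition is_pullback (K : sCat) (A B C P : K) (f : fn A C) (g : fn B C)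
    (p : fn P A) (q : fn P B) : Prop :=
  f ∘ p = g ∘ q /\
  forall (X : K) n (a : Map X A n) (b : Map X B n),
    deg n f ∘ a = deg n g ∘ b ->
    exists! c : Map X P n, deg n p ∘ c = a /\ deg n q ∘ c = b.

(* [cone : U -> map(P,A)] exhibits [P] as the cotensor of [A] by [U], i.e., it
   induces isomorphisms map(X,P) -> map(X,A)^U; an [n]-simplex of the right-hand
   side is a simplicial map from U x Delta^n to map(X,A). *)
Definition is_cotensor (K : sCat) (U : sSet) (A P : K) (cone : sHom U (Map P A)) :
    Prop :=
  forall (X : K) n (t : sHom (sprod U (Delta n)) (Map X A)),
    exists! c : Map X P n, forall m (u : U m) (a : mono m n),
      t m (u, a) = cone m u ∘ act a c.

(* [m : V ⋔ A -> U ⋔ B] is induced by [i : U -> V] and [f : A -> B]. *)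
Definition cotensor_map (K : sCat) (U V : sSet) (A B PV PU : K)
    (coneV : sHom V (Map PV A)) (coneU : sHom U (Map PU B))
    (i : sHom U V) (f : fn A B) (m : fn PV PU) : Prop :=
  forall n (u : U n), coneU n u ∘ deg n m = deg n f ∘ coneV n (i n u).

Definition sHom_id (X : sSet) : sHom X X.
Proof. by exists (fun n x => x). Defined.

(** * Infinity-cosmoi with all objects cofibrant *)

Definition is_iso1 (K : sCat) (A B : K) (f : fn A B) : Prop :=
  exists g : fn B A, g ∘ f = sid A /\ f ∘ g = sid B.

Definition equivalence1 (K : sCat) (A B : K) (f : fn A B) : Prop :=
  forall X : K, qcat_equivalence (post X f).

(* Identities are isofibrations by [isofib_iso], so the isofibrations form a
   subcategory.  In [isofib_leibniz] the pullback of [Ep] along [iB] exists,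
   since [Ep] is an isofibration (case of the empty U of the same axiom). *)
Record is_cosmos (K : sCat) (isofib : forall A B : K, fn A B -> Prop) : Prop :=
  IsCosmos {
  map_quasi_category : forall A B : K, quasi_category (Map A B);
  isofib_comp : forall (A B C : K) (g : fn B C) (f : fn A B),
    isofib _ _ g -> isofib _ _ f -> isofib _ _ (g ∘ f);
  has_terminal : exists T : K, is_terminal T;
  has_cotensors : forall (U : sSet) (A : K), finitely_presented U ->
    exists (P : K) (cone : sHom U (Map P A)), is_cotensor cone;
  has_isofib_pullbacks : forall (A B C : K) (f : fn A C) (g : fn B C),
    isofib _ _ f -> exists (P : K) (p : fn P A) (q : fn P B), is_pullback f g p q;
  isofib_iso : forall (A B : K) (f : fn A B), is_iso1 f -> isofib _ _ f;
  isofib_terminal : forall (A T : K) (f : fn A T), is_terminal T -> isofib _ _ f;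
  isofib_pullback : forall (A B C P : K) (f : fn A C) (g : fn B C)
      (p : fn P A) (q : fn P B),
    is_pullback f g p q -> isofib _ _ f -> isofib _ _ q;
  isofib_leibniz : forall (E B : K) (p : fn E B) (U V : sSet) (i : sHom U V)
      (VE UE VB UB : K)
      (kVE : sHom V (Map VE E)) (kUE : sHom U (Map UE E))
      (kVB : sHom V (Map VB B)) (kUB : sHom U (Map UB B))
      (Ep : fn UE UB) (iB : fn VB UB) (iE : fn VE UE) (Vp : fn VE VB)
      (P : K) (x : fn P UE) (y : fn P VB) (m : fn VE P),
    isofib _ _ p -> finitely_presented U -> finitely_presented V ->
    injective_shom i ->
    is_cotensor kVE -> is_cotensor kUE -> is_cotensor kVB -> is_cotensor kUB ->
    cotensor_map kUE kUB (sHom_id U) p Ep ->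
    cotensor_map kVB kUB i (sid B) iB ->
    cotensor_map kVE kUE i (sid E) iE ->
    cotensor_map kVE kVB (sHom_id V) p Vp ->
    is_pullback Ep iB x y ->
    x ∘ m = iE -> y ∘ m = Vp ->
    isofib _ _ m;
  isofib_map : forall (X E B : K) (p : fn E B),
    isofib _ _ p -> qcat_isofibration (post X p);
  all_cofibrant : forall (X E B : K) (p : fn E B) (b : fn X B),
    isofib _ _ p -> equivalence1 p -> exists e : fn X E, p ∘ e = b }.

Record cosmos := Cosmos {
  cosmos_cat :> sCat;
  isofib : forall A B : cosmos_cat, fn A B -> Prop;
  cosmos_axioms : is_cosmos isofib }.

(** * The homotopy 2-category *)

Definition cell (K : sCat) (A B : K) (f g : fn A B) : Type := @harr (Map A B) f g.

Definition cell_id (K : sCat) (A B : K) (f : fn A B) : cell f f := hid f.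

(* Vertical composition, in diagrammatic order, up to an equation between the
   1-cells in the middle (composition of 1-cells is only provably associative). *)
Definition vcomp (K : sCat) (A B : K) (f g g' h : fn A B)
    (p : cell f g) (e : g = g') (q : cell g' h) : cell f h :=
  hcomp (hcast erefl e p) q.

Definition cell_cast (K : sCat) (A B : K) (f f' g g' : fn A B)
    (ef : f = f') (eg : g = g') (p : cell f g) : cell f' g' := hcast ef eg p.

Lemma postE (K : sCat) (X A B : K) (b : fn A B) (f : fn X A) :
  post X b 0 f = b ∘ f.
Proof. by rewrite /= deg0. Qed.

Lemma preE (K : sCat) (A B Y : K) (a : fn A B) (f : fn B Y) :
  pre Y a 0 f = f ∘ a.
Proof. by rewrite /= deg0. Qed.

Definition whiskL (K : sCat) (X A B : K) (b : fn A B) (f g : fn X A)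
    (p : cell f g) : cell (b ∘ f) (b ∘ g) :=
  cell_cast (postE b f) (postE b g) (hmap (post X b) p).

Definition whiskR (K : sCat) (A B Y : K) (f g : fn B Y) (p : cell f g)
    (a : fn A B) : cell (f ∘ a) (g ∘ a) :=
  cell_cast (preE a f) (preE a g) (hmap (pre Y a) p).

Definition is_iso2 (K : sCat) (A B : K) (f g : fn A B) (p : cell f g) : Prop :=
  exists q : cell g f,
    vcomp p erefl q = cell_id f /\ vcomp q erefl p = cell_id g.

(* A 2-cell of the homotopy 2-category, seen in that of the dual. *)
Definition cell_co (K : sCat) (A B : K) (f g : fn A B) (p : cell f g) :
  @cell (co K) A B g f := harr_op p.

(** ** Adjunctions and mates *)

Lemma fn1l (K : sCat) (A B : K) (f : fn A B) : sid B ∘ f = f.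
Proof. by rewrite -{1}(deg0 (sid B)) scomp1l. Qed.

Lemma fn1r (K : sCat) (A B : K) (f : fn A B) : f ∘ sid A = f.
Proof. by rewrite -{1}(deg0 (sid A)) scomp1r. Qed.

Definition is_adjunction (K : sCat) (X Y : K) (l : fn X Y) (r : fn Y X)
    (eta : cell (sid X) (r ∘ l)) (eps : cell (l ∘ r) (sid Y)) : Prop :=
  cell_cast (fn1r l) (fn1l l)
    (vcomp (whiskL l eta) (scompA l r l) (whiskR eps l)) = cell_id l /\
  cell_cast (fn1l r) (fn1r r)
    (vcomp (whiskR eta r) (esym (scompA r l r)) (whiskL r eps)) = cell_id r.

Lemma mate_right_eq1 (K : sCat) (XA XB XC XD : K) (F : fn XA XB) (H : fn XB XD)
    (Rg : fn XC XA) (Rh : fn XD XB) :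
  (Rh ∘ H) ∘ (F ∘ Rg) = Rh ∘ ((H ∘ F) ∘ Rg).
Proof. by rewrite !scompA. Qed.

Lemma mate_right_eq2 (K : sCat) (XA XB XC XD : K) (G : fn XA XC) (M : fn XC XD)
    (Rg : fn XC XA) (Rh : fn XD XB) :
  Rh ∘ ((M ∘ G) ∘ Rg) = Rh ∘ (M ∘ (G ∘ Rg)).
Proof. by rewrite !scompA. Qed.

Lemma mate_right_eq3 (K : sCat) (XB XC XD : K) (M : fn XC XD) (Rh : fn XD XB) :
  Rh ∘ (M ∘ sid XC) = Rh ∘ M.
Proof. by rewrite fn1r. Qed.

Lemma mate_left_eq1 (K : sCat) (XA XB XC XD : K) (F : fn XA XB) (H : fn XB XD)
    (Lf : fn XB XA) (Lk : fn XD XC) :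
  (Lk ∘ H) ∘ (F ∘ Lf) = Lk ∘ ((H ∘ F) ∘ Lf).
Proof. by rewrite !scompA. Qed.

Lemma mate_left_eq2 (K : sCat) (XA XB XC XD : K) (G : fn XA XC) (M : fn XC XD)
    (Lf : fn XB XA) (Lk : fn XD XC) :
  Lk ∘ ((M ∘ G) ∘ Lf) = (Lk ∘ M) ∘ (G ∘ Lf).
Proof. by rewrite !scompA. Qed.

(* For s : HF => MG, H -| Rh with unit eta, and G -| Rg with counit eps: the composite
   F Rg => Rh H F Rg => Rh M G Rg => Rh M. *)
Definition mate_right (K : sCat) (XA XB XC XD : K)
    (F : fn XA XB) (H : fn XB XD) (G : fn XA XC) (M : fn XC XD)
    (s : cell (H ∘ F) (M ∘ G)) (Rg : fn XC XA) (Rh : fn XD XB)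
    (eta : cell (sid XB) (Rh ∘ H)) (eps : cell (G ∘ Rg) (sid XC)) :
    cell (F ∘ Rg) (Rh ∘ M) :=
  cell_cast (fn1l (F ∘ Rg)) (mate_right_eq3 M Rh)
    (vcomp (vcomp (whiskR eta (F ∘ Rg))
                  (mate_right_eq1 F H Rg Rh)
                  (whiskL Rh (whiskR s Rg)))
           (mate_right_eq2 G M Rg Rh)
           (whiskL Rh (whiskL M eps))).

(* For s : HF => MG, Lf -| F with unit eta, and Lk -| M with counit eps: the composite
   Lk H => Lk H F Lf => Lk M G Lf => G Lf. *)
Definition mate_left (K : sCat) (XA XB XC XD : K)
    (F : fn XA XB) (H : fn XB XD) (G : fn XA XC) (M : fn XC XD)
    (s : cell (H ∘ F) (M ∘ G)) (Lf : fn XB XA) (Lk : fn XD XC)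
    (eta : cell (sid XB) (F ∘ Lf)) (eps : cell (Lk ∘ M) (sid XC)) :
    cell (Lk ∘ H) (G ∘ Lf) :=
  cell_cast (fn1r (Lk ∘ H)) (fn1l (G ∘ Lf))
    (vcomp (vcomp (whiskL (Lk ∘ H) eta)
                  (mate_left_eq1 F H Lf Lk)
                  (whiskL Lk (whiskR s Lf)))
           (mate_left_eq2 G M Lf Lk)
           (whiskR eps (G ∘ Lf))).

(** * Comma squares and pointwise Kan extensions *)

(* The vertices of Delta^1 and its non-degenerate edge. *)
Definition D1_vertex (i : 'I_2) : Delta 1 0 := mono_const 0 i.
Definition D1_edge : Delta 1 1 := mono_id 1.

(* D is the pullback of (ev_1, ev_0) : Delta^1 ⋔ A -> A x A along
   g x f : C x B -> A x A, with projections p1 : D -> C and p0 : D -> B, and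
   phi is represented by the restriction along D -> Delta^1 ⋔ A of the
   universal edge of map(Delta^1 ⋔ A, A). *)
Definition comma_square (K : sCat) (A B C D : K) (f : fn B A) (g : fn C A)
    (p0 : fn D B) (p1 : fn D C) (phi : cell (f ∘ p0) (g ∘ p1)) : Prop :=
  exists (A2 : K) (cone : sHom (Delta 1) (Map A2 A))
         (AA : K) (a1 a0 : fn AA A) (CB : K) (cC : fn CB C) (cB : fn CB B)
         (ev10 : fn A2 AA) (gf : fn CB AA) (m : fn D A2) (q : fn D CB)
         (e : edge (f ∘ p0) (g ∘ p1)),
    [/\ is_cotensor cone, is_product a1 a0, is_product cC cB,
        a1 ∘ ev10 = cone 0 (D1_vertex ord_max) /\ a0 ∘ ev10 = cone 0 (D1_vertex ord0)
      & a1 ∘ gf = g ∘ cC /\ a0 ∘ gf = f ∘ cB] /\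
    [/\ is_pullback ev10 gf m q, cC ∘ q = p1, cB ∘ q = p0,
        sval e = cone 1 D1_edge ∘ deg 1 m
      & phi = hpi (wedge e)].

Definition is_right_ext (K : sCat) (A B C : K) (k : fn A B) (f : fn A C)
    (r : fn B C) (mu : cell (r ∘ k) f) : Prop :=
  forall (e : fn B C) (al : cell (e ∘ k) f),
    exists! be : cell e r, vcomp (whiskR be k) erefl mu = al.

(* The pasting of mu : rk => f with la : bh => kg, of type rbh => rkg => fg. *)
Definition paste_square (K : sCat) (A B C D E : K) (k : fn A B) (f : fn A C)
    (r : fn B C) (mu : cell (r ∘ k) f) (h : fn D E) (g : fn D A) (b : fn E B)
    (la : cell (b ∘ h) (k ∘ g)) : cell ((r ∘ b) ∘ h) (f ∘ g) :=
  cell_cast (scompA r b h) erefl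
    (vcomp (whiskL r la) (scompA r k g) (whiskR mu g)).

Definition is_pointwise_right_kan (K : sCat) (A B C : K) (k : fn A B) (f : fn A C)
    (r : fn B C) (mu : cell (r ∘ k) f) : Prop :=
  is_right_ext mu /\
  forall (D E : K) (h : fn D E) (g : fn D A) (b : fn E B)
    (la : cell (b ∘ h) (k ∘ g)),
    comma_square la -> is_right_ext (paste_square mu la).

(* The pointwise right Kan extensions of the dual infinity-cosmos; they only
   depend on its underlying simplicial category [co K]. *)
Definition is_pointwise_left_kan (K : sCat) (A B C : K) (k : fn A B) (f : fn A C)
    (l : fn B C) (mu : cell f (l ∘ k)) : Prop :=
  @is_pointwise_right_kan (co K) A B C k f l (cell_co mu).

(** * Cartesian closed structure *)

(* The chosen natural isomorphisms map(X,A) x map(X,B) = map(X, A x B) and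
   map(A x X, C) = map(X, C^A) are given by [pairing] and [curry], inverse to
   composing with the projections, resp. with the evaluation A x C^A -> C.  The
   second variable adjunction map(X x A, C) = map(X, C^A) follows by the
   symmetry of the product. *)
Record cartesian_closed (K : sCat) := CartesianClosed {
  prd : K -> K -> K;
  fst1 : forall A B : K, fn (prd A B) A;
  snd1 : forall A B : K, fn (prd A B) B;
  pairing : forall (X A B : K) n, Map X A n -> Map X B n -> Map X (prd A B) n;
  fst_pairing : forall (X A B : K) n (a : Map X A n) (b : Map X B n),
    deg n (fst1 A B) ∘ pairing a b = a;
  snd_pairing : forall (X A B : K) n (a : Map X A n) (b : Map X B n),
    deg n (snd1 A B) ∘ pairing a b = b;
  pair_eta : forall (X A B : K) n (c : Map X (prd A B) n),
    pairing (deg n (fst1 A B) ∘ c) (deg n (snd1 A B) ∘ c) = c;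
  (* [expo C A] is C^A *)
  expo : K -> K -> K;
  ev : forall A C : K, fn (prd A (expo C A)) C;
  curry : forall (A X C : K) n, Map (prd A X) C n -> Map X (expo C A) n;
  ev_curry : forall (A X C : K) n (t : Map (prd A X) C n),
    deg n (ev A C) ∘
      pairing (deg n (fst1 A X)) (curry t ∘ deg n (snd1 A X)) = t;
  curry_ev : forall (A X C : K) n (c : Map X (expo C A) n),
    curry (deg n (ev A C) ∘
      pairing (deg n (fst1 A X)) (c ∘ deg n (snd1 A X))) = c }.

Arguments prd {K} CC A B : rename.
Arguments fst1 {K} CC A B : rename.
Arguments snd1 {K} CC A B : rename.
Arguments pairing {K} CC {X A B n} a b : rename.
Arguments expo {K} CC C A : rename.
Arguments ev {K} CC A C : rename.
Arguments curry {K} CC {A X C n} t : rename.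
Arguments fst_pairing {K} CC {X A B n} a b : rename.
Arguments snd_pairing {K} CC {X A B n} a b : rename.
Arguments pair_eta {K} CC {X A B n} c : rename.
Arguments ev_curry {K} CC {A X C n} t : rename.
Arguments curry_ev {K} CC {A X C n} c : rename.

(* The action of the product on n-simplices of mapping spaces. *)
Definition cross (K : sCat) (CC : cartesian_closed K) (A A' B B' : K) n
    (x : Map A A' n) (y : Map B B' n) : Map (prd CC A B) (prd CC A' B') n :=
  pairing CC (x ∘ deg n (fst1 CC A B)) (y ∘ deg n (snd1 CC A B)).

Lemma pair_act (K : sCat) (CC : cartesian_closed K) (X A B : K) m n
    (al : mono m n) (a : Map X A n) (b : Map X B n) :
  act al (pairing CC a b) = pairing CC (act al a) (act al b).
Proof.
rewrite -[LHS](pair_eta CC); congr pairing.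
  by rewrite -{2}(fst_pairing CC a b) scomp_act act_deg.
by rewrite -{2}(snd_pairing CC a b) scomp_act act_deg.
Qed.

Lemma pair_comp (K : sCat) (CC : cartesian_closed K) (Y X A B : K) n
    (a : Map X A n) (b : Map X B n) (z : Map Y X n) :
  pairing CC a b ∘ z = pairing CC (a ∘ z) (b ∘ z).
Proof. by rewrite -[LHS](pair_eta CC) !scompA fst_pairing snd_pairing. Qed.

Lemma curry_act (K : sCat) (CC : cartesian_closed K) (A X C : K) m n
    (al : mono m n) (t : Map (prd CC A X) C n) :
  curry CC (act al t) = act al (curry CC t).
Proof.
rewrite -[RHS](curry_ev CC) -{1}(ev_curry CC t).
by rewrite scomp_act pair_act scomp_act !act_deg.
Qed.

(* The simplicial isomorphism map(A x X, C) = map(X, C^A). *)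
Definition transpose (K : sCat) (CC : cartesian_closed K) (A X C : K) :
  sHom (Map (prd CC A X) C) (Map X (expo CC C A)).
Proof. by exists (fun n t => curry CC t) => m n a x; apply: curry_act. Defined.

Lemma expo_act (K : sCat) (CC : cartesian_closed K) (A B C : K) m n
    (a : mono m n) (u : Map B A n) :
  curry CC (deg m (ev CC A C) ∘ cross CC (act a u) (deg m (sid (expo CC C A)))) =
  act a (curry CC (deg n (ev CC A C) ∘ cross CC u (deg n (sid (expo CC C A))))).
Proof. by rewrite -curry_act /cross scomp_act pair_act !scomp_act !act_deg. Qed.

(* E^(-) : map(B,A) -> map(E^A, E^B), the transpose of precomposition. *)
Definition expo_map (K : sCat) (CC : cartesian_closed K) (E A B : K) :
  sHom (Map B A) (Map (expo CC E A) (expo CC E B)).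
Proof.
exists (fun n u => curry CC (deg n (ev CC A E) ∘ cross CC u (deg n (sid (expo CC E A))))).
by move=> m n a u; apply: expo_act.
Defined.

(* u^* = E^u *)
Definition restr (K : sCat) (CC : cartesian_closed K) (E A B : K) (u : fn B A) :
  fn (expo CC E A) (expo CC E B) := expo_map CC E A B 0 u.

Lemma restr_comp (K : sCat) (CC : cartesian_closed K) (E A B D : K)
    (u : fn B A) (v : fn D B) :
  restr CC E (u ∘ v) = restr CC E v ∘ restr CC E u.
Proof.
rewrite -[RHS](curry_ev CC); congr curry.
set z := deg 0 (ev CC A E) ∘ _.
pose w := deg 0 (ev CC A E) ∘ cross CC u (deg 0 (sid (expo CC E A))).
have := ev_curry CC w; rewrite -[curry _ w]/(restr CC E u) => Hu.
pose w' := deg 0 (ev CC B E) ∘ cross CC v (deg 0 (sid (expo CC E B))).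
have := ev_curry CC w'; rewrite -[curry _ w']/(restr CC E v) => Hv.
have pc : pairing CC (deg 0 (fst1 CC D (expo CC E A)))
    (restr CC E v ∘ restr CC E u ∘ deg 0 (snd1 CC D (expo CC E A))) =
  pairing CC (deg 0 (fst1 CC D (expo CC E B)))
    (restr CC E v ∘ deg 0 (snd1 CC D (expo CC E B))) ∘
  cross CC (deg 0 (sid D)) (restr CC E u).
  by rewrite pair_comp /cross fst_pairing -!scompA snd_pairing scomp1l !scompA.
rewrite pc scompA Hv /w' -scompA.
have pc2 : cross CC v (deg 0 (sid (expo CC E B))) ∘
    cross CC (deg 0 (sid D)) (restr CC E u) =
  pairing CC (deg 0 (fst1 CC B (expo CC E A)))
    (restr CC E u ∘ deg 0 (snd1 CC B (expo CC E A))) ∘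
  cross CC v (deg 0 (sid (expo CC E A))).
  rewrite /cross !pair_comp -!scompA !fst_pairing !snd_pairing.
  by rewrite !scomp1l.
rewrite pc2 scompA Hu /w /z -scompA; congr (_ ∘ _).
by rewrite /cross !pair_comp -!scompA !fst_pairing !snd_pairing !scomp1l.
Qed.

(* la^* : h^* f^* => k^* g^* for la : f h => g k. *)
Definition restr_square (K : sCat) (CC : cartesian_closed K) (E A B C D : K)
    (f : fn B A) (g : fn C A) (h : fn D B) (k : fn D C)
    (la : cell (f ∘ h) (g ∘ k)) :
  cell (restr CC E h ∘ restr CC E f) (restr CC E k ∘ restr CC E g) :=
  cell_cast (restr_comp CC E f h) (restr_comp CC E g k)
    (hmap (expo_map CC E A D) la).

(** * Functorial pointwise Kan extensions *)

(* k x E^A *)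
Definition times_expo (K : sCat) (CC : cartesian_closed K) (E A B : K) (k : fn A B) :
    fn (prd CC A (expo CC E A)) (prd CC B (expo CC E A)) :=
  cross CC k (sid (expo CC E A)).

Lemma curry_evaluation (K : sCat) (CC : cartesian_closed K) (E A : K) :
  curry CC (ev CC A E) = sid (expo CC E A).
Proof.
rewrite -[RHS](curry_ev CC); congr curry.
have -> : sid (expo CC E A) ∘ deg 0 (snd1 CC A (expo CC E A)) =
    deg 0 (snd1 CC A (expo CC E A)) by rewrite deg0 fn1l.
rewrite -[X in pairing CC X _]scomp1r -[X in pairing CC _ X]scomp1r pair_eta.
by rewrite scomp1r deg0.
Qed.

Lemma curry_times_expo (K : sCat) (CC : cartesian_closed K) (E A B : K)
    (k : fn A B) (r : fn (prd CC B (expo CC E A)) E) :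
  curry CC (r ∘ times_expo CC E k) = restr CC E k ∘ curry CC r.
Proof.
rewrite -[RHS](curry_ev CC); congr curry.
pose w := deg 0 (ev CC B E) ∘ cross CC k (deg 0 (sid (expo CC E B))).
have := ev_curry CC w; rewrite -[curry _ w]/(restr CC E k) => Hk.
have := ev_curry CC r => Hr.
have pc : pairing CC (deg 0 (fst1 CC A (expo CC E A)))
    (restr CC E k ∘ curry CC r ∘ deg 0 (snd1 CC A (expo CC E A))) =
  pairing CC (deg 0 (fst1 CC A (expo CC E B)))
    (restr CC E k ∘ deg 0 (snd1 CC A (expo CC E B))) ∘
  cross CC (deg 0 (sid A)) (curry CC r).
  by rewrite pair_comp /cross fst_pairing -!scompA snd_pairing scomp1l !scompA.
rewrite pc scompA Hk /w -scompA.
have pc2 : cross CC k (deg 0 (sid (expo CC E B))) ∘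
    cross CC (deg 0 (sid A)) (curry CC r) =
  pairing CC (deg 0 (fst1 CC B (expo CC E A)))
    (curry CC r ∘ deg 0 (snd1 CC B (expo CC E A))) ∘ times_expo CC E k.
  rewrite /times_expo /cross !pair_comp -!scompA !fst_pairing !snd_pairing.
  by rewrite !scomp1l fn1l.
by rewrite pc2 scompA Hr.
Qed.

(* r : B x E^A -> E together with nu : r (k x E^A) => ev *)
Definition functorial_pointwise_ran (K : sCat) (CC : cartesian_closed K)
    (E A B : K) (k : fn A B) (r : fn (prd CC B (expo CC E A)) E)
    (nu : cell (r ∘ times_expo CC E k) (ev CC A E)) : Prop :=
  is_pointwise_right_kan nu.

Definition functorial_pointwise_lan (K : sCat) (CC : cartesian_closed K)
    (E A B : K) (k : fn A B) (l : fn (prd CC B (expo CC E A)) E)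
    (nu : cell (ev CC A E) (l ∘ times_expo CC E k)) : Prop :=
  is_pointwise_left_kan nu.

Definition ran_counit (K : sCat) (CC : cartesian_closed K) (E A B : K)
    (k : fn A B) (r : fn (prd CC B (expo CC E A)) E)
    (nu : cell (r ∘ times_expo CC E k) (ev CC A E)) :
  cell (restr CC E k ∘ curry CC r) (sid (expo CC E A)) :=
  cell_cast (curry_times_expo k r) (curry_evaluation CC E A)
    (hmap (transpose CC A (expo CC E A) E) nu).

Definition lan_unit (K : sCat) (CC : cartesian_closed K) (E A B : K)
    (k : fn A B) (l : fn (prd CC B (expo CC E A)) E)
    (nu : cell (ev CC A E) (l ∘ times_expo CC E k)) :
  cell (sid (expo CC E A)) (restr CC E k ∘ curry CC l) :=
  cell_cast (curry_evaluation CC E A) (curry_times_expo k l)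
    (hmap (transpose CC A (expo CC E A) E) nu).

(* Main.v *)
From mathcomp Require Import all_boot.
From mathcomp Require Import boolp zify.
Require Import Defs.

Set Implicit Arguments.
Unset Strict Implicit.
Unset Printing Implicit Defensive.

(** The theorem says that two right liftings of one functor coincide.  Let [k^*]
    be restriction along [k : A -> B].  Under the adjunction [A × - ⊣ (-)^A], a
    right extension along [k × Y] is the same thing as a right lifting of a
    functor [Y -> E^A] through [k^*] ([right_lift_of_ext]).  The mate
    [f^* ran_g => ran_h k^*] is, by the triangle identity for [ran_h], the
    comparison between two functors over [k^*]; it is invertible as soon as both
    are right liftings of [k^*] through [h^*] ([rmate_invertible]).  After
    transposition this asks for two right extensions along [h × E^C]:

    - [rg (f × E^C)], obtained by pasting [rg] with [lambda × E^C];
    - [rh (B × E^k)], obtained by whiskering [rh] with [k^*].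

    Neither square is a comma square, so pointwiseness does not apply at once.
    The comma of [f × y] and [g × X], for [y : Y -> X], is the product of the comma
    [D] of [f] and [g] with the comma [Q] of [y] and the identity of [X]
    ([is_comma_cross]).  The projection [Q -> Y] has a left adjoint section, so
    that [D × Y -> D × Q] is a left adjoint over [B × Y]; right extensions survive
    precomposition with such a functor ([right_ext_precomp_left_adjoint]), and
    this turns the comma square of the product into the square [lambda × y]
    ([pointwise_cross_comma]).  With [y] the identity this is the first extension.
    For the second, take for [lambda] the comma of the identity of [B] and [k]:
    its projection to [A] has a right adjoint section, and precomposing with it
    replaces the comma by [k] itself ([pointwise_cross]).  The same lemma says that
    the counit is an absolute right lifting, which produces the adjunction
    [k^* ⊣ ran_k] ([adjunction_of_right_lift]).

    The cosmos enters through the existence of all comma objects, which comes from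
    the axiom on Leibniz cotensors, applied to the inclusion of the two endpoints
    in [Delta 1] ([cosmos_has_commas]).  Comma objects and closed structures
    pass to the dual simplicial category, with [f] and [g] exchanged, so the
    statement on left extensions is the statement on right extensions in the dual.

    Composition of functors is associative up to a propositional equality only,
    and the 2-cells of the homotopy 2-category carry their source and target in
    their types.  All calculations are therefore made with arrows that forget
    their endpoints, where no transport occurs. *)

(** * Arrows of homotopy categories *)

(** An arrow of the homotopy category of [X], with its endpoints as data instead
    of as indices: equations between arrows need no transport along equations
    between endpoints. *)
Record arrow (X : sSet) := Arrow {
  asrc : X 0;
  atgt : X 0;
  acls : harr asrc atgt }.

Lemma arrow_cast (X : sSet) (x x' y y' : X 0) (ex : x = x') (ey : y = y')
    (p : harr x y) : Arrow (hcast ex ey p) = Arrow p.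
Proof. by case: x' / ex; case: y' / ey. Qed.

Lemma arrow_inj (X : sSet) (x y : X 0) (p q : harr x y) :
  Arrow p = Arrow q -> p = q.
Proof.
pose c (P : arrow X) (ex : asrc P = x) (ey : atgt P = y) := hcast ex ey (acls P).
suff H P Q ex ey ex' ey' : P = Q -> @c P ex ey = @c Q ex' ey'.
  by move=> /(H (Arrow p) (Arrow q) erefl erefl erefl erefl).
by move=> PQ; subst Q; congr c; apply: Prop_irrelevance.
Qed.

Definition aid (X : sSet) (x : X 0) : arrow X := Arrow (hid x).

(** Composition in diagrammatic order.  The value [P] when the endpoints do
    not match makes [asrc_vc] unconditional. *)
Definition vc (X : sSet) (P Q : arrow X) : arrow X :=
  match pselect (atgt P = asrc Q) with
  | left e => Arrow (hcomp (hcast erefl e (acls P)) (acls Q))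
  | right _ => P
  end.

Notation "P ⋅ Q" := (vc P Q) (at level 45, left associativity).

Lemma vcE (X : sSet) (x y z : X 0) (p : harr x y) (q : harr y z) :
  Arrow p ⋅ Arrow q = Arrow (hcomp p q).
Proof.
rewrite /vc; case: pselect => //= e; congr (Arrow (hcomp _ _)).
by apply: arrow_inj; apply: (arrow_cast erefl e p).
Qed.

Definition earr (X : sSet) (z : X 1) : arrow X :=
  Arrow (hpi (wedge (exist _ z (conj erefl erefl) : edge (vsrc z) (vtgt z)))).

Lemma arrow_edge (X : sSet) (x y : X 0) (e : edge x y) :
  Arrow (hpi (wedge e)) = earr (sval e).
Proof.
by case: e => z [ex ey]; case: x / ex; case: y / ey.
Qed.

(** Edges generate the homotopy category, so an identity that is natural in
    arrows has to be checked on identities, edges and composites only. *)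
Lemma arrow_edge_ind (X : sSet) (Pr : arrow X -> Prop) :
  (forall x, Pr (aid x)) -> (forall z, Pr (earr z)) ->
  (forall P Q, atgt P = asrc Q -> Pr P -> Pr Q -> Pr (P ⋅ Q)) ->
  forall P, Pr P.
Proof.
move=> H1 He Hc [x y p]; rewrite -(reprK p) -/(hpi _); move: (repr p) => w {p}.
elim: x y / w => [x|x y e|x y z w1 IH1 w2 IH2].
- exact: H1.
- by rewrite arrow_edge.
- by rewrite -hcomp_hpi -vcE; apply: Hc.
Qed.

Lemma asrc_vc (X : sSet) (P Q : arrow X) : asrc (P ⋅ Q) = asrc P.
Proof. by rewrite /vc; case: pselect. Qed.

Lemma atgt_vc (X : sSet) (P Q : arrow X) : atgt P = asrc Q -> atgt (P ⋅ Q) = atgt Q.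
Proof. by rewrite /vc; case: pselect. Qed.

Lemma vc_idl (X : sSet) (x : X 0) (P : arrow X) : asrc P = x -> aid x ⋅ P = P.
Proof.
case: P => a y p /= ax; subst a; rewrite vcE; congr Arrow.
rewrite -(reprK p) -/(hpi _) /hid hcomp_hpi; apply: hpi_eq; exact: wrel_idl.
Qed.

Lemma vc_idr (X : sSet) (x : X 0) (P : arrow X) : atgt P = x -> P ⋅ aid x = P.
Proof.
case: P => a y p /= ax; subst x; rewrite vcE; congr Arrow.
rewrite -(reprK p) -/(hpi _) /hid hcomp_hpi; apply: hpi_eq; exact: wrel_idr.
Qed.

Lemma vcA (X : sSet) (P Q R : arrow X) : atgt P = asrc Q -> atgt Q = asrc R ->
  P ⋅ (Q ⋅ R) = P ⋅ Q ⋅ R.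
Proof.
case: P Q R => [x y p] [y' z q] [z' t r] /= e1 e2; subst y' z'.
rewrite !vcE; congr Arrow.
rewrite -(reprK p) -(reprK q) -(reprK r) -!/(hpi _) !hcomp_hpi.
by apply: hpi_eq; apply: wrel_assoc.
Qed.

Lemma earr_deg (X : sSet) (x : X 0) : earr (deg 1 x) = aid x.
Proof.
rewrite -(arrow_edge (deg_edge x)); congr Arrow; apply: hpi_eq; exact: wrel_deg.
Qed.

Lemma earr_triangle (X : sSet) (s : X 2) :
  earr (act (coface (inord 2 : 'I_3)) s) ⋅ earr (act (coface (inord 0 : 'I_3)) s) =
  earr (act (coface (inord 1 : 'I_3)) s).
Proof.
have E (i j i' j' : nat) : i < 2 -> i' < 2 -> j < 3 -> j' < 3 ->
    bump j (bump i 0) = bump j' (bump i' 0) ->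
    act (coface (inord i : 'I_2)) (act (coface (inord j : 'I_3)) s) =
    act (coface (inord i' : 'I_2)) (act (coface (inord j' : 'I_3)) s).
  move=> ? ? ? ? H; rewrite !act_comp; congr act; apply: mono_ext => t.
  rewrite !mono_compE !mk_monoE [t]ord1; apply: val_inj.
  by rewrite /= !inordK //.
have o0 : ord0 = inord 0 :> 'I_2 by apply: val_inj; rewrite /= inordK.
have o1 : ord_max = inord 1 :> 'I_2 by apply: val_inj; rewrite /= inordK.
pose d i := act (coface (inord i : 'I_3)) s.
have e12 : vsrc (d 0) = vtgt (d 2) by rewrite /vsrc /vtgt o0 o1 /d; apply: E.
have e1 : vsrc (d 1) = vsrc (d 2) by rewrite /vsrc o1 /d; apply: E.
have e2 : vtgt (d 1) = vtgt (d 0) by rewrite /vtgt o0 /d; apply: E.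
pose a : edge (vsrc (d 2)) (vtgt (d 2)) := exist _ (d 2) (conj erefl erefl).
pose b : edge (vtgt (d 2)) (vtgt (d 0)) := exist _ (d 0) (conj e12 erefl).
pose c : edge (vsrc (d 2)) (vtgt (d 0)) := exist _ (d 1) (conj e1 e2).
rewrite -!/(d _) -(arrow_edge a) -(arrow_edge b) -(arrow_edge c) vcE hcomp_hpi.
by congr Arrow; apply: hpi_eq; apply: (@wrel_tri _ _ _ _ s).
Qed.

(** Whiskering, transposition and the passage to exponentials are all actions of
    simplicial maps; identities between them then follow from identities between
    simplicial maps, by [amap_ext] and [amap_comp]. *)
Definition amap (X Y : sSet) (F : sHom X Y) (P : arrow X) : arrow Y :=
  Arrow (hmap F (acls P)).

Lemma amap_cls (X Y : sSet) (F : sHom X Y) (x y : X 0) (p : harr x y) :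
  amap F (Arrow p) = Arrow (hmap F p).
Proof. by []. Qed.

Lemma amap_id (X Y : sSet) (F : sHom X Y) (x : X 0) :
  amap F (aid x) = aid (F 0 x).
Proof. by rewrite /amap /= /hid hmap_hpi. Qed.

Lemma amap_earr (X Y : sSet) (F : sHom X Y) (z : X 1) :
  amap F (earr z) = earr (F 1 z).
Proof. by rewrite /amap /= hmap_hpi /= arrow_edge. Qed.

Lemma amap_vc (X Y : sSet) (F : sHom X Y) (P Q : arrow X) : atgt P = asrc Q ->
  amap F (P ⋅ Q) = amap F P ⋅ amap F Q.
Proof.
case: P Q => [x y p] [y' z q] /= e; subst y'; rewrite vcE !amap_cls vcE.
by rewrite -(reprK p) -(reprK q) -!/(hpi _) hcomp_hpi !hmap_hpi hcomp_hpi.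
Qed.

Lemma amap_ext (X Y : sSet) (F G : sHom X Y) (P : arrow X) :
  (forall n x, F n x = G n x) -> amap F P = amap G P.
Proof.
move=> FG; elim/arrow_edge_ind: P => [x|z|P Q PQ IP IQ].
- by rewrite !amap_id FG.
- by rewrite !amap_earr FG.
- by rewrite !amap_vc // IP IQ.
Qed.

Lemma amap_comp (X Y Z : sSet) (G : sHom Y Z) (F : sHom X Y) (P : arrow X) :
  amap G (amap F P) = amap (shom_comp G F) P.
Proof.
elim/arrow_edge_ind: P => [x|z|P Q PQ IP IQ].
- by rewrite !amap_id.
- by rewrite !amap_earr.
- by rewrite !amap_vc ?IP ?IQ //= PQ.
Qed.

Lemma amap_idmap (X : sSet) (P : arrow X) : amap (sHom_id X) P = P.
Proof.
elim/arrow_edge_ind: P => [x|z|P Q PQ IP IQ].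
- by rewrite amap_id.
- by rewrite amap_earr.
- by rewrite amap_vc // IP IQ.
Qed.

Definition aop (X : sSet) (P : arrow X) : arrow (sop X) :=
  Arrow (harr_op (acls P)).

Lemma aop_id (X : sSet) (x : X 0) : aop (aid x) = @aid (sop X) x.
Proof. by rewrite /aop /= harr_op_hpi. Qed.

Lemma aop_earr (X : sSet) (z : X 1) : aop (earr z) = @earr (sop X) z.
Proof. by rewrite /aop /= harr_op_hpi /= arrow_edge. Qed.

Lemma aop_vc (X : sSet) (P Q : arrow X) : atgt P = asrc Q ->
  aop (P ⋅ Q) = aop Q ⋅ aop P.
Proof.
case: P Q => [x y p] [y' z q] /= e; subst y'; rewrite vcE /aop vcE /=.
by rewrite -(reprK p) -(reprK q) -!/(hpi _) hcomp_hpi !harr_op_hpi hcomp_hpi.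
Qed.

Lemma mono_revK m n (a : mono m n) : mono_rev (mono_rev a) = a.
Proof. by apply: mono_ext => i; rewrite !mk_monoE !rev_ordK. Qed.

Definition sop_map (X Y : sSet) (F : sHom X Y) : sHom (sop X) (sop Y).
Proof.
apply: (@SHom (sop X) (sop Y) (fun n (x : X n) => (F n x : Y n))) => m n a x.
exact: (sfun_act F (mono_rev a) x).
Defined.

(** The double opposite is isomorphic, but not convertible, to [X]. *)
Definition sop_sop (X : sSet) : sHom (sop (sop X)) X.
Proof.
apply: (@SHom (sop (sop X)) X (fun n (x : X n) => x)) => m n a x.
by rewrite /= mono_revK.
Defined.

Lemma aop_amap (X Y : sSet) (F : sHom X Y) (P : arrow X) :
  aop (amap F P) = amap (sop_map F) (aop P).
Proof.
elim/arrow_edge_ind: P => [x|z|P Q PQ IP IQ].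
- by rewrite amap_id !aop_id amap_id.
- by rewrite amap_earr !aop_earr amap_earr.
- by rewrite !(amap_vc, aop_vc) ?IP ?IQ //= PQ.
Qed.

Definition aunop (X : sSet) (P : arrow (sop X)) : arrow X := amap (sop_sop X) (aop P).

Lemma aopK (X : sSet) (P : arrow X) : aunop (aop P) = P.
Proof.
rewrite /aunop; elim/arrow_edge_ind: P => [x|z|P Q PQ IP IQ].
- by rewrite !aop_id amap_id.
- by rewrite !aop_earr amap_earr.
- by rewrite !(amap_vc, aop_vc) ?IP ?IQ //= PQ.
Qed.

Lemma aunopK (X : sSet) (P : arrow (sop X)) : aop (aunop P) = P.
Proof.
rewrite /aunop; elim/arrow_edge_ind: P => [x|z|P Q PQ IP IQ].
- by rewrite !aop_id amap_id !aop_id.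
- by rewrite !aop_earr amap_earr aop_earr.
- by rewrite !(amap_vc, aop_vc) ?IP ?IQ //= PQ.
Qed.

(** * Whiskering and interchange *)

Definition wL (K : sCat) (X A B : K) (b : fn A B) (P : arrow (Map X A)) :
  arrow (Map X B) := amap (post X b) P.

Definition wR (K : sCat) (A B Y : K) (P : arrow (Map B Y)) (a : fn A B) :
  arrow (Map A Y) := amap (pre Y a) P.

Section Whisker.
Variable K : sCat.
Implicit Types A B C D X Y : K.

Lemma asrc_wL X A B (b : fn A B) (P : arrow (Map X A)) :
  asrc (wL b P) = b ∘ asrc P.
Proof. by rewrite /= deg0. Qed.
Lemma atgt_wL X A B (b : fn A B) (P : arrow (Map X A)) :
  atgt (wL b P) = b ∘ atgt P.
Proof. by rewrite /= deg0. Qed.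
Lemma asrc_wR A B Y (P : arrow (Map B Y)) (a : fn A B) :
  asrc (wR P a) = asrc P ∘ a.
Proof. by rewrite /= deg0. Qed.
Lemma atgt_wR A B Y (P : arrow (Map B Y)) (a : fn A B) :
  atgt (wR P a) = atgt P ∘ a.
Proof. by rewrite /= deg0. Qed.

Lemma deg_scomp A B C n (g : fn B C) (f : fn A B) :
  deg n (g ∘ f) = deg n g ∘ deg n f.
Proof. by rewrite /deg scomp_act. Qed.

Lemma wL_id X A B (b : fn A B) (f : fn X A) : wL b (aid f) = aid (b ∘ f).
Proof. by rewrite /wL amap_id /= deg0. Qed.
Lemma wR_id A B Y (f : fn B Y) (a : fn A B) : wR (aid f) a = aid (f ∘ a).
Proof. by rewrite /wR amap_id /= deg0. Qed.
Lemma wL_earr X A B (b : fn A B) (z : Map X A 1) : wL b (earr z) = earr (deg 1 b ∘ z).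
Proof. exact: amap_earr. Qed.
Lemma wR_earr A B Y (z : Map B Y 1) (a : fn A B) : wR (earr z) a = earr (z ∘ deg 1 a).
Proof. exact: amap_earr. Qed.
Lemma wL_vc X A B (b : fn A B) (P Q : arrow (Map X A)) : atgt P = asrc Q ->
  wL b (P ⋅ Q) = wL b P ⋅ wL b Q.
Proof. exact: amap_vc. Qed.
Lemma wR_vc A B Y (P Q : arrow (Map B Y)) (a : fn A B) : atgt P = asrc Q ->
  wR (P ⋅ Q) a = wR P a ⋅ wR Q a.
Proof. exact: amap_vc. Qed.
Lemma wL_wL X A B C (c : fn B C) (b : fn A B) (P : arrow (Map X A)) :
  wL c (wL b P) = wL (c ∘ b) P.
Proof. by rewrite /wL amap_comp; apply: amap_ext => n x; rewrite /= deg_scomp scompA. Qed.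
Lemma wR_wR X A B Y (P : arrow (Map B Y)) (b : fn A B) (a : fn X A) :
  wR (wR P b) a = wR P (b ∘ a).
Proof. by rewrite /wR amap_comp; apply: amap_ext => n x; rewrite /= deg_scomp scompA. Qed.
Lemma wL_wR X A B C (c : fn B C) (P : arrow (Map A B)) (a : fn X A) :
  wL c (wR P a) = wR (wL c P) a.
Proof. by rewrite /wL /wR !amap_comp; apply: amap_ext => n x; rewrite /= scompA. Qed.
Lemma wL1 X A (P : arrow (Map X A)) : wL (sid A) P = P.
Proof.
rewrite -[RHS]amap_idmap; apply: amap_ext => n x; exact: scomp1l.
Qed.
Lemma wR1 X A (P : arrow (Map X A)) : wR P (sid X) = P.
Proof.
rewrite -[RHS]amap_idmap; apply: amap_ext => n x; exact: scomp1r.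
Qed.

Lemma deg_vsrc (X : sSet) n (z : X 1) :
  deg n (vsrc z) = act (mono_const n (ord0 : 'I_2)) z.
Proof.
rewrite /deg /vsrc act_comp; congr act; apply: mono_ext => i.
by rewrite mono_compE !mk_monoE; apply: val_inj.
Qed.

Lemma deg_vtgt (X : sSet) n (z : X 1) :
  deg n (vtgt z) = act (mono_const n (ord_max : 'I_2)) z.
Proof.
rewrite /deg /vtgt act_comp; congr act; apply: mono_ext => i.
by rewrite mono_compE !mk_monoE; apply: val_inj.
Qed.

(** For [k] equal to 0 or 1, the codegeneracy from [2] to [1] that repeats the
    value [1 - k]. *)
Definition degen2 (k : nat) : mono 2 1.
Proof.
apply: (@mk_mono 2 1 (fun i => inord (k < i))) => i j ij.
have B (b : bool) : (inord b : 'I_2) = b :> nat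
  by rewrite inordK // ltnS leq_b1.
rewrite !B; case: (ltnP k i) => // ki.
by rewrite (leq_trans ki ij).
Defined.

Lemma degen2_coface k j (a : mono 1 1) : j < 3 ->
  (forall i : 'I_2, (k < bump j i) = a i :> nat) ->
  mono_comp (degen2 k) (coface (inord j : 'I_3)) = a.
Proof.
move=> j3 H; apply: mono_ext => i; rewrite mono_compE !mk_monoE; apply: ord_inj.
rewrite inordK ?ltnS ?leq_b1 // -H; congr (nat_of_bool (_ < _)).
by rewrite /= inordK.
Qed.

(** The square [z × w] of edges is divided into two triangles by its diagonal
    [z ∘ w]. *)
Lemma earr_scomp A B C (z : Map B C 1) (w : Map A B 1) :
  earr (z ∘ deg 1 (vsrc w)) ⋅ earr (deg 1 (vtgt z) ∘ w) = earr (z ∘ w) /\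
  earr (deg 1 (vsrc z) ∘ w) ⋅ earr (z ∘ deg 1 (vtgt w)) = earr (z ∘ w).
Proof.
pose id1 := mono_id 1; pose c0 := mono_const 1 (ord0 : 'I_2).
pose c1 := mono_const 1 (ord_max : 'I_2).
have D k j (a : mono 1 1) : j < 3 -> (forall i : 'I_2, (k < bump j i) = a i :> nat) ->
  mono_comp (degen2 k) (coface (inord j : 'I_3)) = a by apply: degen2_coface.
have E02 : mono_comp (degen2 0) (coface (inord 2 : 'I_3)) = id1.
  by apply: D => // -[[|[|]]] //= p; rewrite mk_monoE.
have E00 : mono_comp (degen2 0) (coface (inord 0 : 'I_3)) = c1.
  by apply: D => // -[[|[|]]] //= p; rewrite mk_monoE.
have E01 : mono_comp (degen2 0) (coface (inord 1 : 'I_3)) = id1.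
  by apply: D => // -[[|[|]]] //= p; rewrite mk_monoE.
have E12 : mono_comp (degen2 1) (coface (inord 2 : 'I_3)) = c0.
  by apply: D => // -[[|[|]]] //= p; rewrite mk_monoE.
have E10 : mono_comp (degen2 1) (coface (inord 0 : 'I_3)) = id1.
  by apply: D => // -[[|[|]]] //= p; rewrite mk_monoE.
have E11 : mono_comp (degen2 1) (coface (inord 1 : 'I_3)) = id1.
  by apply: D => // -[[|[|]]] //= p; rewrite mk_monoE.
rewrite !deg_vsrc !deg_vtgt -/c0 -/c1; split.
- have := earr_triangle (act (degen2 0) z ∘ act (degen2 1) w).
  by rewrite !scomp_act !act_comp E02 E00 E01 E12 E10 E11 !act_id.
- have := earr_triangle (act (degen2 1) z ∘ act (degen2 0) w).
  by rewrite !scomp_act !act_comp E02 E00 E01 E12 E10 E11 !act_id.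
Qed.

Definition whisker_ends := (asrc_wL, atgt_wL, asrc_wR, atgt_wR).

Lemma interchange A B C (P : arrow (Map B C)) (Q : arrow (Map A B)) :
  wR P (asrc Q) ⋅ wL (atgt P) Q = wL (asrc P) Q ⋅ wR P (atgt Q).
Proof.
elim/arrow_edge_ind: P => [b|z|P P' e IP IP'].
- by rewrite !wR_id vc_idl ?vc_idr // ?asrc_wL ?atgt_wL.
- elim/arrow_edge_ind: Q => [a|w|Q Q' e IQ IQ'].
  + by rewrite !wL_id vc_idl ?vc_idr // ?asrc_wR ?atgt_wR.
  + rewrite !wL_earr !wR_earr; have [-> ->] // := earr_scomp z w.
  + rewrite asrc_vc atgt_vc // !wL_vc //.
    rewrite vcA ?whisker_ends ?e // IQ -vcA ?whisker_ends // e ?IQ' //.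
    by rewrite vcA // ?whisker_ends ?e.
- rewrite asrc_vc atgt_vc // !wR_vc // -vcA ?whisker_ends ?e // IP'.
  rewrite vcA ?whisker_ends // -?e ?IP //.
  by rewrite vcA ?whisker_ends ?e.
Qed.
End Whisker.

(** * Extensions, liftings, adjunctions and mates *)

Definition between (X : sSet) (x y : X 0) (P : arrow X) : Prop :=
  asrc P = x /\ atgt P = y.

Lemma between_arrow (X : sSet) (x y : X 0) (P : arrow X) :
  between x y P -> exists p : harr x y, P = Arrow p.
Proof. by case: P => x' y' p [/= ex ey]; subst x' y'; exists p. Qed.

Definition invertible (X : sSet) (P : arrow X) : Prop :=
  exists Q, [/\ between (atgt P) (asrc P) Q, P ⋅ Q = aid (asrc P)
              & Q ⋅ P = aid (atgt P)].

Section TwoCells.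
Variable K : sCat.
Implicit Types A B C D X Y Z W XA XB XC XD : K.

Lemma arrow_whiskL X A B (b : fn A B) (f g : fn X A) (p : cell f g) :
  Arrow (whiskL b p) = wL b (Arrow p).
Proof. by rewrite /whiskL /cell_cast arrow_cast. Qed.

Lemma arrow_whiskR A B Y (f g : fn B Y) (p : cell f g) (a : fn A B) :
  Arrow (whiskR p a) = wR (Arrow p) a.
Proof. by rewrite /whiskR /cell_cast arrow_cast. Qed.

Lemma arrow_vcomp A B (f g g' h : fn A B) (p : cell f g) (e : g = g')
    (q : cell g' h) : Arrow (vcomp p e q) = Arrow p ⋅ Arrow q.
Proof. by rewrite /vcomp -vcE arrow_cast. Qed.

Lemma arrow_cell_cast A B (f f' g g' : fn A B) (ef : f = f') (eg : g = g')
    (p : cell f g) : Arrow (cell_cast ef eg p) = Arrow p.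
Proof. exact: arrow_cast. Qed.

Definition arrowE :=
  (arrow_whiskL, arrow_whiskR, arrow_vcomp, arrow_cell_cast).

Definition right_ext A B C (k : fn A B) (f : fn A C) (r : fn B C)
    (M : arrow (Map A C)) : Prop :=
  between (r ∘ k) f M /\
  forall (e : fn B C) (al : arrow (Map A C)), between (e ∘ k) f al ->
    exists! be : arrow (Map B C), between e r be /\ wR be k ⋅ M = al.

(** What [right_ext] becomes when functors are reversed; transposition turns one
    into the other. *)
Definition right_lift Y Z W (L : fn Y Z) (z : fn W Z) (l : fn W Y)
    (M : arrow (Map W Z)) : Prop :=
  between (L ∘ l) z M /\
  forall (e : fn W Y) (al : arrow (Map W Z)), between (L ∘ e) z al ->
    exists! be : arrow (Map W Y), between e l be /\ wL L be ⋅ M = al.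

Lemma right_extP A B C (k : fn A B) (f : fn A C) (r : fn B C) (mu : cell (r ∘ k) f) :
  is_right_ext mu <-> right_ext k f r (Arrow mu).
Proof.
split=> [H|[_ H] e al].
  split=> // e al /between_arrow [a ->{al}].
  have [b [Hb Hu]] := H e a; exists (Arrow b); split.
    by split=> //; rewrite -Hb !arrowE.
  move=> _ [/between_arrow [b' ->] E]; congr Arrow; apply: Hu.
  by apply: arrow_inj; rewrite !arrowE.
have [_ [[/between_arrow [b ->] E] Hu]] := H e (Arrow al) (conj erefl erefl).
exists b; split.
  by apply: arrow_inj; rewrite !arrowE.
move=> b' E'; apply: arrow_inj; apply: Hu; split=> //.
by rewrite -E' !arrowE.
Qed.

Definition adjunction X Y (l : fn X Y) (r : fn Y X) (eta : arrow (Map X X))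
    (eps : arrow (Map Y Y)) : Prop :=
  [/\ between (sid X) (r ∘ l) eta, between (l ∘ r) (sid Y) eps,
      wL l eta ⋅ wR eps l = aid l & wR eta r ⋅ wL r eps = aid r].

Lemma is_adjunctionP X Y (l : fn X Y) (r : fn Y X)
    (eta : cell (sid X) (r ∘ l)) (eps : cell (l ∘ r) (sid Y)) :
  is_adjunction eta eps <-> adjunction l r (Arrow eta) (Arrow eps).
Proof.
split=> [[H1 H2]|[_ _ H1 H2]].
  have E1 := congr1 (fun p => Arrow p) H1; have E2 := congr1 (fun p => Arrow p) H2.
  by split=> //; [rewrite -[RHS]E1|rewrite -[RHS]E2]; rewrite !arrowE.
by split; apply: arrow_inj; rewrite !arrowE ?H1 ?H2.
Qed.

Lemma is_iso2P A B (f g : fn A B) (p : cell f g) :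
  is_iso2 p <-> invertible (Arrow p).
Proof.
split=> [[q [H1 H2]]|[_ [/between_arrow [q ->] H1 H2]]].
  by exists (Arrow q); split; rewrite // ?vcE; [rewrite -[aid _]/(Arrow (cell_id f)) -H1
    |rewrite -[aid _]/(Arrow (cell_id g)) -H2]; rewrite !arrowE vcE.
by exists q; split; apply: arrow_inj; rewrite !arrowE ?H1 ?H2.
Qed.

Definition rmate XA XB XC XD (F : fn XA XB) (M : fn XC XD) (Rg : fn XC XA)
    (Rh : fn XD XB) (s : arrow (Map XA XD)) (eta : arrow (Map XB XB))
    (eps : arrow (Map XC XC)) : arrow (Map XC XB) :=
  wR eta (F ∘ Rg) ⋅ wL Rh (wR s Rg) ⋅ wL Rh (wL M eps).

Lemma arrow_mate_right XA XB XC XD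
    (F : fn XA XB) (H : fn XB XD) (G : fn XA XC) (M : fn XC XD)
    (s : cell (H ∘ F) (M ∘ G)) (Rg : fn XC XA) (Rh : fn XD XB)
    (eta : cell (sid XB) (Rh ∘ H)) (eps : cell (G ∘ Rg) (sid XC)) :
  Arrow (mate_right s eta eps) = rmate F M Rg Rh (Arrow s) (Arrow eta) (Arrow eps).
Proof. by rewrite /mate_right !arrowE. Qed.

Definition lmate XA XB XC XD (H : fn XB XD) (G : fn XA XC) (Lf : fn XB XA)
    (Lk : fn XD XC) (s : arrow (Map XA XD)) (eta : arrow (Map XB XB))
    (eps : arrow (Map XC XC)) : arrow (Map XB XC) :=
  wL (Lk ∘ H) eta ⋅ wL Lk (wR s Lf) ⋅ wR eps (G ∘ Lf).

Lemma arrow_mate_left XA XB XC XD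
    (F : fn XA XB) (H : fn XB XD) (G : fn XA XC) (M : fn XC XD)
    (s : cell (H ∘ F) (M ∘ G)) (Lf : fn XB XA) (Lk : fn XD XC)
    (eta : cell (sid XB) (F ∘ Lf)) (eps : cell (Lk ∘ M) (sid XC)) :
  Arrow (mate_left s eta eps) = lmate H G Lf Lk (Arrow s) (Arrow eta) (Arrow eps).
Proof. by rewrite /mate_left !arrowE. Qed.

Lemma arrow_paste_square A B C D E (k : fn A B) (f : fn A C)
    (r : fn B C) (mu : cell (r ∘ k) f) (h : fn D E) (g : fn D A) (b : fn E B)
    (la : cell (b ∘ h) (k ∘ g)) :
  Arrow (paste_square mu la) = wL r (Arrow la) ⋅ wR (Arrow mu) g.
Proof. by rewrite /paste_square !arrowE. Qed.

Lemma right_lift_inj Y Z W (L : fn Y Z) (z : fn W Z) (l e : fn W Y) M b b' :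
  right_lift L z l M -> between e l b -> between e l b' ->
  wL L b ⋅ M = wL L b' ⋅ M -> b = b'.
Proof.
move=> [[sM tM] uM] bb bb' E; have [sb tb] := bb.
have [|I [_ uI]] := uM e (wL L b ⋅ M).
  by split; rewrite ?asrc_vc ?atgt_vc ?whisker_ends ?sb ?tb ?sM.
by rewrite -(uI b) // -(uI b').
Qed.

(** Two right liftings of the same functor are related by a unique comparison,
    with inverse the comparison in the other direction. *)
Lemma right_lift_iso Y Z W (L : fn Y Z) (z : fn W Z) (l l' : fn W Y) M M' P :
  right_lift L z l M -> right_lift L z l' M' -> between l l' P ->
  wL L P ⋅ M' = M -> invertible P.
Proof.
move=> rM rM' bP PM; have [[bM uM] [bM' uM']] := (rM, rM').
have [sP tP] := bP; have [sM tM] := bM; have [sM' tM'] := bM'.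
have [Q [[bQ QM] _]] := uM l' M' bM'; have [sQ tQ] := bQ.
exists Q; split; first by rewrite sP tP.
- rewrite sP; apply: (right_lift_inj rM (e := l)) => //.
    by split; rewrite ?asrc_vc ?atgt_vc ?tP.
  rewrite wL_vc ?tP // -vcA ?whisker_ends ?tP ?sQ ?tQ // QM PM.
  by rewrite wL_id vc_idl.
- rewrite tP; apply: (right_lift_inj rM' (e := l')) => //.
    by split; rewrite ?asrc_vc ?atgt_vc ?tQ.
  rewrite wL_vc ?tQ // -vcA ?whisker_ends ?tQ ?sP ?tP // PM QM.
  by rewrite wL_id vc_idl.
Qed.

(** The unit is the factorisation of the identity of [L] through the lifting of
    [L]; this is one triangle identity, and the other one holds after composition
    with [eps], where interchange reduces it to the first. *)
Lemma adjunction_of_right_lift X Y (L : fn X Y) (R : fn Y X) (eps : arrow (Map Y Y)) :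
  between (L ∘ R) (sid Y) eps ->
  right_lift L L (R ∘ L) (wR eps L) -> right_lift L (sid Y) R eps ->
  exists eta, adjunction L R eta eps.
Proof.
move=> bE [_ uL] r1; have [sE tE] := bE.
have b1 : between (L ∘ sid X) L (aid L) by split; rewrite /= ?fn1r.
have [eta [[bT T1] _]] := uL (sid X) (aid L) b1; have [sT tT] := bT.
exists eta; split=> //.
apply: (right_lift_inj r1 (e := R)) => //.
  split; first by rewrite asrc_vc whisker_ends sT fn1l.
  by rewrite atgt_vc !whisker_ends ?tE ?fn1r // sE tT scompA.
have e1 : atgt (wR eta R) = asrc (wL R eps) by rewrite !whisker_ends sE tT scompA.
rewrite wL_vc // wL_wL wL_wR.
have := interchange eps eps; rewrite sE tE wL1 wR1 => I2.
rewrite -vcA ?whisker_ends ?tT ?sE ?tE ?fn1r ?scompA // -I2.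
rewrite -wR_wR vcA ?whisker_ends ?tT ?sE ?tE ?scompA ?fn1l //.
by rewrite -wR_vc ?whisker_ends ?tT ?sE ?scompA // T1 !wR_id wL_id !vc_idl.
Qed.

(** By the triangle identity for [H ⊣ Rh], composing the mate with the counit of
    [H ⊣ Rh] gives back [s] pasted with [epsg].  The mate is thus the comparison
    between the two right liftings of [M] through [H]. *)
Lemma rmate_invertible XA XB XC XD (F : fn XA XB) (H : fn XB XD) (G : fn XA XC)
    (M : fn XC XD) (Rg : fn XC XA) (Rh : fn XD XB) (s : arrow (Map XA XD))
    (eta : arrow (Map XB XB)) (epsg : arrow (Map XC XC)) (epsh : arrow (Map XD XD)) :
  between (H ∘ F) (M ∘ G) s -> between (G ∘ Rg) (sid XC) epsg ->
  adjunction H Rh eta epsh ->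
  right_lift H M (F ∘ Rg) (wR s Rg ⋅ wL M epsg) ->
  right_lift H M (Rh ∘ M) (wR epsh M) ->
  invertible (rmate F M Rg Rh s eta epsg).
Proof.
move=> [ss ts] [sg tg] [[sT tT] [sE tE] T1 T2] l1 l2.
set c1 := wR s Rg ⋅ wL M epsg in l1.
have ec : atgt (wR s Rg) = asrc (wL M epsg) by rewrite !whisker_ends sg ts scompA.
have [[sc tc] _] := l1.
have -> : rmate F M Rg Rh s eta epsg = wR eta (F ∘ Rg) ⋅ wL Rh c1.
  by rewrite /rmate wL_vc // vcA // !whisker_ends ?tT ?ss ?ts ?sg !scompA.
have e2 : atgt (wR eta (F ∘ Rg)) = asrc (wL Rh c1).
  by rewrite !whisker_ends sc tT !scompA.
apply: (right_lift_iso l1 l2).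
  split; first by rewrite asrc_vc whisker_ends sT fn1l.
  by rewrite atgt_vc // whisker_ends tc.
rewrite wL_vc // wL_wL wL_wR.
have := interchange epsh c1; rewrite sE tE sc tc wL1 => I2.
rewrite -vcA ?whisker_ends ?tT ?sc ?tc ?sE ?scompA // -I2 -(wR_wR epsh).
rewrite vcA ?whisker_ends ?tT ?sE ?tE ?sc ?scompA ?fn1l //.
rewrite -wR_vc ?whisker_ends ?tT ?sE ?scompA // T1 wR_id vc_idl // sc scompA //.
Qed.

(** Here [i ⊣ s] with identity unit and counit [th], and the adjunction lives over
    [B] since [k th] is an identity.  Restriction along [i] is then a bijection
    from 2-cells [e k => f] to 2-cells [e k i => f i], natural in [e]: the inverse
    restricts along [s] and composes with [f th].  Hence it preserves the
    universal property of a right extension. *)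
Lemma right_ext_precomp_left_adjoint A B C D (k : fn A B) (f : fn A C) (r : fn B C)
    (i : fn D A) (s : fn A D) (M : arrow (Map A C)) (th : arrow (Map A A)) :
  right_ext k f r M -> between (i ∘ s) (sid A) th -> s ∘ i = sid D ->
  wL k th = aid k -> wR th i = aid i ->
  right_ext (k ∘ i) (f ∘ i) r (wR M i).
Proof.
move=> [bM uM] [sT tT] si kT Ti; have [sM tM] := bM.
have kis : k ∘ (i ∘ s) = k by rewrite -sT -asrc_wL kT.
split; first by split; rewrite whisker_ends ?sM ?tM ?scompA.
have recover (X : arrow (Map A C)) e : between (e ∘ k) f X ->
    wR (wR X i) s ⋅ wL f th = X.
  move=> [sX tX]; have := interchange X th; rewrite sT tT sX tX wR1 wR_wR => ->.
  by rewrite -wL_wL kT wL_id vc_idl.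
move=> e al [sa ta].
have [|be [[bb E] ub]] := uM e (wR al s ⋅ wL f th).
  split; first by rewrite asrc_vc whisker_ends sa -!scompA kis.
  by rewrite atgt_vc !whisker_ends ?ta ?sT ?tT ?fn1r ?scompA.
have [sb tb] := bb; exists be; split.
  split=> //; rewrite -wR_wR -wR_vc ?whisker_ends ?tb ?sM // E.
  rewrite wR_vc ?whisker_ends ?ta ?sT ?scompA // wR_wR si wR1 -wL_wR Ti wL_id.
  by rewrite vc_idr // ta.
move=> be' [[sb' tb'] E']; apply: ub; split=> //.
rewrite -E' -wR_wR -wR_vc ?whisker_ends ?tb' ?sM // (recover _ e) //.
by split; rewrite ?asrc_vc ?atgt_vc ?whisker_ends ?sb' ?tb' ?sM.
Qed.

(** The same bijection when [s ⊣ i] with identity counit and unit [et]: the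
    inverse now restricts along [s] and composes with [e k et], and it is [f et]
    that has to be an identity. *)
Lemma right_ext_precomp_right_adjoint A B C D (k : fn A B) (f : fn A C) (r : fn B C)
    (i : fn D A) (s : fn A D) (M : arrow (Map A C)) (et : arrow (Map A A)) :
  right_ext k f r M -> between (sid A) (i ∘ s) et -> s ∘ i = sid D ->
  wL f et = aid f -> wR et i = aid i ->
  right_ext (k ∘ i) (f ∘ i) r (wR M i).
Proof.
move=> [bM uM] [sT tT] si fT Ti; have [sM tM] := bM.
have fis : f ∘ (i ∘ s) = f by rewrite -tT -atgt_wL fT.
split; first by split; rewrite whisker_ends ?sM ?tM ?scompA.
have recover (X : arrow (Map A C)) e : between (e ∘ k) f X ->
    wL (e ∘ k) et ⋅ wR (wR X i) s = X.
  move=> [sX tX]; have := interchange X et; rewrite sT tT sX tX wR1 wR_wR => <-.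
  by rewrite fT vc_idr.
move=> e al [sa ta].
have e1 : atgt (wL (e ∘ k) et) = asrc (wR al s).
  by rewrite !whisker_ends sa tT !scompA.
have [|be [[bb E] ub]] := uM e (wL (e ∘ k) et ⋅ wR al s).
  split; first by rewrite asrc_vc whisker_ends sT fn1r.
  by rewrite atgt_vc // whisker_ends ta -scompA fis.
have [sb tb] := bb; exists be; split.
  split=> //; rewrite -wR_wR -wR_vc ?whisker_ends ?tb ?sM // E.
  rewrite wR_vc // wR_wR si wR1 -wL_wR Ti wL_id.
  by rewrite vc_idl // sa scompA.
move=> be' [[sb' tb'] E']; apply: ub; split=> //.
rewrite -E' -wR_wR -wR_vc ?whisker_ends ?tb' ?sM // (recover _ e) //.
by split; rewrite ?asrc_vc ?atgt_vc ?whisker_ends ?sb' ?tb' ?sM.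
Qed.

End TwoCells.

(** * Comma objects as simplicial limits *)

Lemma exists_unique_inj T (P : T -> Prop) x y :
  (exists! c, P c) -> P x -> P y -> x = y.
Proof. by move=> [c [_ u]] Px Py; rewrite -(u x) // (u y). Qed.

(** The simplicial universal property of a comma object, read off from its
    universal edge [z] without mention of a cotensor.  An [n]-simplex of
    [map(X, D)] is a homotopy [t] between the images of [a] and [b], where [t] is a
    simplicial map [Delta 1 × Delta n -> map(X, A)].  Unlike [comma_square] this is
    visibly stable under products and duality. *)
Definition is_comma (K : sCat) (A B C D : K) (f : fn B A) (g : fn C A)
    (p0 : fn D B) (p1 : fn D C) (z : Map D A 1) : Prop :=
  [/\ vsrc z = f ∘ p0, vtgt z = g ∘ p1 &
    forall (X : K) n (a : Map X B n) (b : Map X C n)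
      (t : sHom (sprod (Delta 1) (Delta n)) (Map X A)),
      t n (mono_const n ord0, mono_id n) = deg n f ∘ a ->
      t n (mono_const n ord_max, mono_id n) = deg n g ∘ b ->
      exists! c : Map X D n, [/\ deg n p0 ∘ c = a, deg n p1 ∘ c = b &
        forall m (u : mono m 1) (x : mono m n), t m (u, x) = act u z ∘ act x c]].

Section Comma.
Variable K : sCat.
Implicit Types A B C D X Y : K.

(** The homotopy that corresponds to the simplex [c] when [z] is a universal
    edge. *)
Definition homotopy_of X D A n (z : Map D A 1) (c : Map X D n) :
  sHom (sprod (Delta 1) (Delta n)) (Map X A).
Proof.
exists (fun m ux => act (ux.1 : mono m 1) z ∘ act (ux.2 : mono m n) c).
by move=> l m a [u x] /=; rewrite scomp_act !act_comp.
Defined.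

Lemma is_comma_inj A B C D (f : fn B A) (g : fn C A) (p0 : fn D B) (p1 : fn D C)
    (z : Map D A 1) X n (c c' : Map X D n) : is_comma f g p0 p1 z ->
  deg n p0 ∘ c = deg n p0 ∘ c' -> deg n p1 ∘ c = deg n p1 ∘ c' ->
  (forall m (u : mono m 1) (x : mono m n), act u z ∘ act x c = act u z ∘ act x c') ->
  c = c'.
Proof.
move=> [sz tz uz] E0 E1 Ez.
have [||d [_ u]] := uz X n (deg n p0 ∘ c) (deg n p1 ∘ c) (homotopy_of z c).
- by rewrite /= act_id -deg_vsrc sz deg_scomp scompA.
- by rewrite /= act_id -deg_vtgt tz deg_scomp scompA.
by rewrite -(u c) // (u c').
Qed.

Lemma is_product_inj A B P (p : fn P A) (q : fn P B) X n (c c' : Map X P n) :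
  is_product p q -> deg n p ∘ c = deg n p ∘ c' -> deg n q ∘ c = deg n q ∘ c' ->
  c = c'.
Proof.
by move=> H E1 E2; apply: (exists_unique_inj (H X n (deg n p ∘ c) (deg n q ∘ c))).
Qed.

Lemma is_comma_of_square A B C D (f : fn B A) (g : fn C A) (p0 : fn D B) (p1 : fn D C)
    (phi : cell (f ∘ p0) (g ∘ p1)) : comma_square phi ->
  exists2 e : edge (f ∘ p0) (g ∘ p1), phi = hpi (wedge e) &
    is_comma f g p0 p1 (sval e).
Proof.
move=> [A2 [cone [AA [a1 [a0 [CB [cC [cB [ev10 [gf [m [q [e]]]]]]]]]]]]].
move=> [[ct pA pCB [ev1 ev0] [gf1 gf0]] [[sq pb] qC qB ez ->]].
exists e => //; have [se te] := svalP e; split=> // X n a b t t0 t1.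
have coneE l (u : mono l 1) : cone l u ∘ deg l m = act u (sval e).
  rewrite ez scomp_act act_deg; congr (_ ∘ _).
  by rewrite -sfun_act /= mono_1comp.
have coneV l (i : 'I_2) : cone l (mono_const l i) = deg l (cone 0 (D1_vertex i)).
  rewrite /deg -sfun_act /= /D1_vertex; congr (cone l _).
  by rewrite mono_const_comp.
have [c2 [c2E c2u]] := ct X n t.
have [d [[dC dB] du]] := pCB X n b a.
have [|c [[cm cq] cu]] := pb X n c2 d.
  apply: (is_product_inj pA); rewrite !scompA -!deg_scomp.
    rewrite ev1 gf1 -coneV deg_scomp -scompA dC -t1 c2E.
    by rewrite act_id.
  by rewrite ev0 gf0 -coneV deg_scomp -scompA dB -t0 c2E act_id.
have H c' : [/\ deg n p0 ∘ c' = a, deg n p1 ∘ c' = b &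
    forall l (u : mono l 1) (x : mono l n), t l (u, x) = act u (sval e) ∘ act x c'] <->
    deg n m ∘ c' = c2 /\ deg n q ∘ c' = d.
  split=> [[H0 H1 Hz]|[Hm Hq]].
    split.
      symmetry; apply: c2u => l u x.
      by rewrite scomp_act act_deg scompA coneE Hz.
    by symmetry; apply: du; rewrite !scompA -!deg_scomp qC qB.
  split; first by rewrite -qB deg_scomp -scompA Hq.
    by rewrite -qC deg_scomp -scompA Hq.
  by move=> l u x; rewrite c2E -Hm scomp_act act_deg scompA coneE.
exists c; split; first exact/H.
by move=> c' /H; apply: cu.
Qed.

End Comma.

Section Cross.
Variables (K : sCat) (CC : cartesian_closed K).
Implicit Types A B C D X Y : K.

(** * Products of comma objects *)

Lemma pair_ext X A B n (c c' : Map X (prd CC A B) n) :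
  deg n (fst1 CC A B) ∘ c = deg n (fst1 CC A B) ∘ c' ->
  deg n (snd1 CC A B) ∘ c = deg n (snd1 CC A B) ∘ c' -> c = c'.
Proof. by move=> E1 E2; rewrite -[c](pair_eta CC) E1 E2 pair_eta. Qed.

Lemma prd_is_product A B : is_product (fst1 CC A B) (snd1 CC A B).
Proof.
move=> X n a b; exists (pairing CC a b); split.
  by rewrite fst_pairing snd_pairing.
by move=> c [<- <-]; rewrite pair_eta.
Qed.

Lemma fst_pairing0 X A B (a : fn X A) (b : fn X B) :
  fst1 CC A B ∘ pairing CC a b = a.
Proof. by have := fst_pairing CC a b; rewrite deg0. Qed.

Lemma snd_pairing0 X A B (a : fn X A) (b : fn X B) :
  snd1 CC A B ∘ pairing CC a b = b.
Proof. by have := snd_pairing CC a b; rewrite deg0. Qed.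

Lemma fst_cross A A' B B' n (x : Map A A' n) (y : Map B B' n) :
  deg n (fst1 CC A' B') ∘ cross CC x y = x ∘ deg n (fst1 CC A B).
Proof. exact: fst_pairing. Qed.

Lemma snd_cross A A' B B' n (x : Map A A' n) (y : Map B B' n) :
  deg n (snd1 CC A' B') ∘ cross CC x y = y ∘ deg n (snd1 CC A B).
Proof. exact: snd_pairing. Qed.

Lemma cross_comp A A' A'' B B' B'' n (x : Map A A' n) (y : Map B B' n)
    (x' : Map A' A'' n) (y' : Map B' B'' n) :
  cross CC x' y' ∘ cross CC x y = cross CC (x' ∘ x) (y' ∘ y).
Proof. by rewrite /cross pair_comp -!scompA fst_pairing snd_pairing. Qed.

Lemma cross_act A A' B B' m n (u : mono m n) (x : Map A A' n) (y : Map B B' n) :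
  act u (cross CC x y) = cross CC (act u x) (act u y).
Proof. by rewrite /cross pair_act !scomp_act !act_deg. Qed.

Lemma deg_cross A A' B B' n (x : fn A A') (y : fn B B') :
  deg n (cross CC x y) = cross CC (deg n x) (deg n y).
Proof. exact: cross_act. Qed.

Lemma cross_id A B : cross CC (sid A) (sid B) = sid (prd CC A B).
Proof.
by apply: pair_ext; rewrite ?fst_cross ?snd_cross deg0 fn1l fn1r.
Qed.

Lemma is_comma_cross A B C D (f : fn B A) (g : fn C A) (p0 : fn D B) (p1 : fn D C)
    (z : Map D A 1) A' B' C' D' (f' : fn B' A') (g' : fn C' A') (p0' : fn D' B')
    (p1' : fn D' C') (z' : Map D' A' 1) :
  is_comma f g p0 p1 z -> is_comma f' g' p0' p1' z' ->
  is_comma (cross CC f f') (cross CC g g') (cross CC p0 p0') (cross CC p1 p1')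
    (cross CC z z').
Proof.
move=> [sz tz uz] [sz' tz' uz']; split.
- by rewrite /vsrc cross_act -!/(vsrc _) sz sz' cross_comp.
- by rewrite /vtgt cross_act -!/(vtgt _) tz tz' cross_comp.
move=> X n a b t t0 t1.
pose fB := deg n (fst1 CC B B'); pose fC := deg n (fst1 CC C C').
pose sB := deg n (snd1 CC B B'); pose sC := deg n (snd1 CC C C').
have [||c [[c0 c1 cz] cu]] :=
    uz X n (fB ∘ a) (fC ∘ b) (shom_comp (post X (fst1 CC A A')) t).
- by rewrite /= t0 deg_cross scompA fst_cross -scompA.
- by rewrite /= t1 deg_cross scompA fst_cross -scompA.
have [||c' [[c0' c1' cz'] cu']] :=
    uz' X n (sB ∘ a) (sC ∘ b) (shom_comp (post X (snd1 CC A A')) t).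
- by rewrite /= t0 deg_cross scompA snd_cross -scompA.
- by rewrite /= t1 deg_cross scompA snd_cross -scompA.
exists (pairing CC c c'); split.
  split.
  - apply: pair_ext; rewrite deg_cross scompA ?fst_cross ?snd_cross -scompA.
      by rewrite fst_pairing c0.
    by rewrite snd_pairing c0'.
  - apply: pair_ext; rewrite deg_cross scompA ?fst_cross ?snd_cross -scompA.
      by rewrite fst_pairing c1.
    by rewrite snd_pairing c1'.
  - move=> m u x; apply: pair_ext; rewrite cross_act scompA ?fst_cross ?snd_cross.
      by rewrite -scompA pair_act fst_pairing -cz.
    by rewrite -scompA pair_act snd_pairing -cz'.
move=> d [d0 d1 dz]; rewrite -[d](pair_eta CC); congr pairing.
  apply: cu; split.
  - by rewrite /fB -d0 deg_cross scompA [in RHS]scompA fst_cross.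
  - by rewrite /fC -d1 deg_cross scompA [in RHS]scompA fst_cross.
  by move=> m u x; rewrite /= dz cross_act scompA fst_cross scomp_act act_deg scompA.
apply: cu'; split.
- by rewrite /sB -d0 deg_cross scompA [in RHS]scompA snd_cross.
- by rewrite /sC -d1 deg_cross scompA [in RHS]scompA snd_cross.
by move=> m u x; rewrite /= dz cross_act scompA snd_cross scomp_act act_deg scompA.
Qed.

(** The cotensor of [A] by [Delta 1] is itself a comma object, that of the
    identity of [A] with itself; [D] is the pullback prescribed by [comma_square]
    because both represent the same homotopies. *)
Lemma comma_square_of_is_comma A B C D (f : fn B A) (g : fn C A) (p0 : fn D B) (p1 : fn D C)
    (e : edge (f ∘ p0) (g ∘ p1)) A2 (q0 q1 : fn A2 A) (w : Map A2 A 1) :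
  is_comma (sid A) (sid A) q0 q1 w -> is_comma f g p0 p1 (sval e) ->
  comma_square (hpi (wedge e)).
Proof.
move=> uw uz; have [sw tw uw'] := uw; have [sz tz uz'] := uz.
rewrite fn1l in sw; rewrite fn1l in tw.
have coneP m n (a : mono m n) (u : mono n 1) : act (mono_comp u a) w = act a (act u w).
  by rewrite act_comp.
pose cone : sHom (Delta 1) (Map A2 A) :=
  @SHom (Delta 1) (Map A2 A) (fun m (u : mono m 1) => act u w) coneP.
have ct : is_cotensor cone.
  move=> X n t.
  have [||c [[c0 c1 cz] cu]] := uw' X n (t n (mono_const n ord0, mono_id n))
      (t n (mono_const n ord_max, mono_id n)) t; rewrite ?scomp1l //.
  exists c; split=> // c' Hc'; apply: cu; split=> //.
    by rewrite Hc' /= act_id -deg_vsrc sw.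
  by rewrite Hc' /= act_id -deg_vtgt tw.
have tP l m (a : mono l m) (ux : sprod (Delta 1) (Delta 0) m) :
    act ((act a ux).1 : mono l 1) (sval e) = act a (act (ux.1 : mono m 1) (sval e)).
  by rewrite /= act_comp.
have [m [mE _]] := ct D 0 (@SHom (sprod (Delta 1) (Delta 0)) (Map D A)
  (fun m ux => act (ux.1 : mono m 1) (sval e)) tP).
have {}mE l (u : mono l 1) : act u w ∘ deg l m = act u (sval e).
  by rewrite /deg -(mE l u (mono_const l ord0)).
have mV0 : q0 ∘ m = f ∘ p0.
  have := mE 0 (mono_const 0 ord0).
  by rewrite -!deg_vsrc !deg0 sw sz.
have mV1 : q1 ∘ m = g ∘ p1.
  have := mE 0 (mono_const 0 ord_max).
  by rewrite -!deg_vtgt !deg0 tw tz.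
exists A2, cone, (prd CC A A), (fst1 CC A A), (snd1 CC A A), (prd CC C B),
  (fst1 CC C B), (snd1 CC C B), (pairing CC q1 q0),
  (pairing CC (g ∘ fst1 CC C B) (f ∘ snd1 CC C B)), m, (pairing CC p1 p0), e.
split; split=> //; try exact: prd_is_product.
- rewrite fst_pairing0 snd_pairing0 /= /D1_vertex.
  by rewrite -deg_vsrc -deg_vtgt !deg0 sw tw.
- by rewrite fst_pairing0 snd_pairing0.
- split.
    by rewrite !pair_comp -!scompA fst_pairing0 snd_pairing0 mV0 mV1.
  move=> X n a b ab.
  have ab1 : deg n q1 ∘ a = deg n g ∘ (deg n (fst1 CC C B) ∘ b).
    have := congr1 (fun c => deg n (fst1 CC A A) ∘ c) ab.
    by rewrite !scompA -!deg_scomp !fst_pairing0.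
  have ab0 : deg n q0 ∘ a = deg n f ∘ (deg n (snd1 CC C B) ∘ b).
    have := congr1 (fun c => deg n (snd1 CC A A) ∘ c) ab.
    by rewrite !scompA -!deg_scomp !snd_pairing0.
  have [||c [[c0 c1 cz] cu]] := uz' X n (deg n (snd1 CC C B) ∘ b)
      (deg n (fst1 CC C B) ∘ b) (homotopy_of w a).
  + by rewrite /= act_id -deg_vsrc sw.
  + by rewrite /= act_id -deg_vtgt tw.
  exists c; split.
    split; last by apply: pair_ext; rewrite scompA -deg_scomp ?fst_pairing0 ?snd_pairing0.
    apply: (exists_unique_inj (ct X n (homotopy_of w a))) => // l u x.
    by rewrite cz scomp_act act_deg scompA /= mE.
  move=> c' [mc qc]; apply: cu; split.
  + by rewrite -qc scompA -deg_scomp snd_pairing0.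
  + by rewrite -qc scompA -deg_scomp fst_pairing0.
  + by move=> l u x; rewrite /= -mc scomp_act act_deg scompA mE.
- by rewrite fst_pairing0.
- by rewrite snd_pairing0.
- by rewrite /= mE act_id.
Qed.
End Cross.

(** * Adjoint sections of comma projections *)

Lemma mono_min_homo m (u x : mono m 1) (i j : 'I_m.+1) : i <= j ->
  (if u i <= x i then u i else x i) <= (if u j <= x j then u j else x j).
Proof.
move=> ij; have := mono_le u ij; have := mono_le x ij.
by case: (leqP (u i) (x i)); case: (leqP (u j) (x j)) => *; lia.
Qed.

Definition mono_min m (u x : mono m 1) : mono m 1 := mk_mono (@mono_min_homo m u x).

Lemma mono_min_comp l m (u x : mono m 1) (a : mono l m) :
  mono_comp (mono_min u x) a = mono_min (mono_comp u a) (mono_comp x a).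
Proof. by apply: mono_ext => i; rewrite !mk_monoE. Qed.

Lemma mono_min0l m (x : mono m 1) : mono_min (mono_const m ord0) x = mono_const m ord0.
Proof. by apply: mono_ext => i; rewrite !mk_monoE. Qed.

Lemma mono_min0r m (x : mono m 1) : mono_min x (mono_const m ord0) = mono_const m ord0.
Proof.
apply: mono_ext => i; rewrite !mk_monoE; case: leqP => // H.
by apply: val_inj; move: H => /=; lia.
Qed.

Lemma mono_min1l m (x : mono m 1) : mono_min (mono_const m ord_max) x = x.
Proof.
apply: mono_ext => i; rewrite !mk_monoE; case: leqP => // H.
by apply: val_inj; move: H (ltn_ord (x i)) => /=; lia.
Qed.

Lemma mono_min1r m (x : mono m 1) : mono_min x (mono_const m ord_max) = x.
Proof.
apply: mono_ext => i; rewrite !mk_monoE; case: leqP => // H.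
by apply: val_inj; move: H (ltn_ord (x i)) => /=; lia.
Qed.

Lemma coface_max_comp m (x : mono m 0) :
  mono_comp (coface (ord_max : 'I_2)) x = mono_const m ord0.
Proof.
by apply: mono_ext => i; rewrite mono_compE !mk_monoE; apply: val_inj; rewrite /= [x i]ord1.
Qed.

Lemma coface0_comp m (x : mono m 0) :
  mono_comp (coface (ord0 : 'I_2)) x = mono_const m ord_max.
Proof.
by apply: mono_ext => i; rewrite mono_compE !mk_monoE; apply: val_inj; rewrite /= [x i]ord1.
Qed.

Lemma act_vertex (X : sSet) m (u : mono m 0) (x : X 0) : act u x = deg m x.
Proof. by rewrite -{1}(deg0 x) act_deg. Qed.

Lemma vsrc_deg (X : sSet) (x : X 0) : vsrc (deg 1 x) = x.
Proof. exact: (deg_edge_subproof x).1. Qed.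
Lemma vtgt_deg (X : sSet) (x : X 0) : vtgt (deg 1 x) = x.
Proof. exact: (deg_edge_subproof x).2. Qed.

Lemma vsrc_scomp (K : sCat) (A B C : K) (z : Map B C 1) (w : Map A B 1) :
  vsrc (z ∘ w) = vsrc z ∘ vsrc w.
Proof. exact: scomp_act. Qed.
Lemma vtgt_scomp (K : sCat) (A B C : K) (z : Map B C 1) (w : Map A B 1) :
  vtgt (z ∘ w) = vtgt z ∘ vtgt w.
Proof. exact: scomp_act. Qed.

Section CommaSections.
Variable K : sCat.
Implicit Types A B C D X Y Q : K.

(** The section [i] sends a point [a] of [Y] to the identity of [y a].  It is left
    adjoint to [q0]: the counit [th] is, at an object [p : y a -> b] of [Q], the
    square from the identity of [y a] to [p] with sides the identity and [p].  As
    a homotopy over [Delta 1 × Delta 1] this square is [p] composed with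
    the minimum map to [Delta 1]. *)
Lemma is_comma_left_adjoint_section X Y Q (y : fn Y X) (q0 : fn Q Y) (q1 : fn Q X)
    (w : Map Q X 1) : is_comma y (sid X) q0 q1 w ->
  exists (i : fn Y Q) (th : Map Q Q 1),
    [/\ q0 ∘ i = sid Y, q1 ∘ i = y & w ∘ deg 1 i = deg 1 y] /\
    [/\ vsrc th = i ∘ q0, vtgt th = sid Q, deg 1 q0 ∘ th = deg 1 q0
      & th ∘ deg 1 i = deg 1 i].
Proof.
move=> uw; have [sw tw uw'] := uw; rewrite fn1l in tw.
have kP l m (a : mono l m) (ux : sprod (Delta 1) (Delta 0) m) :
    deg l y = act a (deg m y) by rewrite act_deg.
have [||i [[i0 i1 iE] _]] := uw' Y 0 (sid Y) y
    (@SHom (sprod (Delta 1) (Delta 0)) (Map Y X) (fun m _ => deg m y) kP).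
- by rewrite /= deg0 fn1r.
- by rewrite /= !deg0 fn1l.
rewrite !deg0 in i0 i1.
have {}iE m (u : mono m 1) : act u w ∘ deg m i = deg m y.
  by rewrite /deg -(iE m u (mono_const m ord0)).
have tP l m (a : mono l m) (ux : sprod (Delta 1) (Delta 1) m) :
    act (mono_min (act a ux).1 (act a ux).2) w =
    act a (act (mono_min ux.1 ux.2) w).
  by rewrite act_comp mono_min_comp.
have [||th [[th0 th1 thE] _]] := uw' Q 1 (deg 1 q0) w
    (@SHom (sprod (Delta 1) (Delta 1)) (Map Q X)
       (fun m ux => act (mono_min ux.1 ux.2) w) tP).
- by rewrite /= mono_min0l -deg_vsrc sw deg_scomp.
- by rewrite /= mono_min1l act_id scomp1l.
have {}thE m (u x : mono m 1) : act u w ∘ act x th = act (mono_min u x) w.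
  by rewrite -(thE m u x).
exists i, th; split; first by split=> //; rewrite -{1}[w]act_id iE.
have th0s : q0 ∘ vsrc th = q0 /\ q0 ∘ vtgt th = q0.
  by have := (congr1 (@vsrc _) th0, congr1 (@vtgt _) th0);
    rewrite vsrc_scomp vtgt_scomp !vsrc_deg !vtgt_deg => -[].
have th1s : q1 ∘ vsrc th = y ∘ q0 /\ q1 ∘ vtgt th = q1.
  by have := (congr1 (@vsrc _) th1, congr1 (@vtgt _) th1);
    rewrite vsrc_scomp vtgt_scomp !vsrc_deg !vtgt_deg sw tw => -[].
split=> //.
- apply: (is_comma_inj uw) => [||m u x]; rewrite ?deg0.
  + by rewrite scompA i0 fn1l th0s.1.
  + by rewrite scompA i1 th1s.1.
  + rewrite act_comp thE coface_max_comp mono_min0r -deg_vsrc sw.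
    by rewrite act_vertex !deg_scomp scompA iE.
- apply: (is_comma_inj uw) => [||m u x]; rewrite ?deg0.
  + by rewrite fn1r th0s.2.
  + by rewrite fn1r th1s.2.
  + rewrite act_comp thE coface0_comp mono_min1r.
    by rewrite act_vertex scomp1r.
- apply: (is_comma_inj uw) => [||m u x].
  + by rewrite scompA th0.
  + by rewrite scompA th1 -deg_scomp i1 -{1}[w]act_id iE.
  + by rewrite scomp_act act_deg scompA thE !iE.
Qed.

End CommaSections.

Lemma deg_op (X : sSet) n (x : X 0) : @deg (sop X) n x = deg n x.
Proof.
by rewrite /deg /= mono_rev_const; congr act; congr mono_const; apply: val_inj.
Qed.

Lemma vsrc_op (X : sSet) (z : X 1) : @vsrc (sop X) z = vtgt z.
Proof.
by rewrite /vsrc /vtgt /= mono_rev_coface; congr act; congr coface; apply: val_inj.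
Qed.

Lemma vtgt_op (X : sSet) (z : X 1) : @vtgt (sop X) z = vsrc z.
Proof.
by rewrite /vsrc /vtgt /= mono_rev_coface; congr act; congr coface; apply: val_inj.
Qed.

(** Reversing all edges turns the comma of [f] and [g] into that of [g] and
    [f]. *)
Lemma is_comma_co (K : sCat) (A B C D : K) (f : fn B A) (g : fn C A)
    (p0 : fn D B) (p1 : fn D C) (z : Map D A 1) :
  is_comma f g p0 p1 z -> @is_comma (co K) A C B D g f p1 p0 z.
Proof.
move=> [sz tz uz]; split.
- by rewrite (@vsrc_op (Map D A)).
- by rewrite (@vtgt_op (Map D A)).
move=> X n a b t t0 t1.
have tP l m (v : mono l m) (ux : sprod (Delta 1) (Delta n) m) :
    t l (mono_rev (act v ux).1, mono_rev (act v ux).2) =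
    @act (@Map K X A) _ _ v (t m (mono_rev ux.1, mono_rev ux.2)).
  have := sfun_act t (mono_rev v) (mono_rev ux.1, mono_rev ux.2).
  rewrite /= mono_revK => E; apply: etrans E.
  by rewrite !mono_rev_comp.
have r0 : rev_ord (ord0 : 'I_2) = ord_max by apply: val_inj.
have r1 : rev_ord (ord_max : 'I_2) = ord0 by apply: val_inj.
have [||c [[c0 c1 cz] cu]] := uz X n b a
    (@SHom (sprod (Delta 1) (Delta n)) (@Map K X A)
       (fun m ux => t m (mono_rev ux.1, mono_rev ux.2)) tP).
- by rewrite /= mono_rev_const r0 mono_rev1 t1 (@deg_op (Map B A)).
- by rewrite /= mono_rev_const r1 mono_rev1 t0 (@deg_op (Map C A)).
exists c; split.
  split; rewrite ?(@deg_op (Map D B)) ?(@deg_op (Map D C)) //.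
  move=> m u x; have := cz m (mono_rev u) (mono_rev x).
  by rewrite /= !mono_revK.
rewrite (@deg_op (Map D B)) (@deg_op (Map D C)) => c' [c0' c1' cz'].
apply: cu; split=> // m u x.
by rewrite /= cz' /= !mono_revK.
Qed.

(** This is [is_comma_left_adjoint_section] in the dual: an object of the comma of
    the identity with [k] maps to the identity at its codomain, and this map is the
    unit [et]. *)
Lemma is_comma_right_adjoint_section (K : sCat) (A B Q : K) (k : fn A B) (p0 : fn Q B)
    (p1 : fn Q A) (z : Map Q B 1) : is_comma (sid B) k p0 p1 z ->
  exists (i : fn A Q) (et : Map Q Q 1),
    [/\ p1 ∘ i = sid A, p0 ∘ i = k & z ∘ deg 1 i = deg 1 k] /\
    [/\ vsrc et = sid Q, vtgt et = i ∘ p1, deg 1 p1 ∘ et = deg 1 p1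
      & et ∘ deg 1 i = deg 1 i].
Proof.
move=> /is_comma_co /is_comma_left_adjoint_section [i [et [[i0 i1 iz] [se te e1 ei]]]].
exists i, et; split; first by split=> //; move: iz; rewrite !deg_op.
move: se te e1 ei; rewrite vsrc_op vtgt_op !deg_op => se te e1 ei.
by split.
Qed.

(** * Pointwise extensions along products *)

Definition has_commas (K : sCat) : Prop :=
  forall (A B C : K) (f : fn B A) (g : fn C A),
    exists (D : K) (p0 : fn D B) (p1 : fn D C) (z : Map D A 1), is_comma f g p0 p1 z.

Lemma has_commas_co (K : sCat) : has_commas K -> has_commas (co K).
Proof.
move=> H A B C f g; have [D [p0 [p1 [z uz]]]] := H A C B g f.
by exists D, p1, p0, z; apply: is_comma_co.
Qed.

Section Pointwise.
Variables (K : sCat) (CC : cartesian_closed K) (commas : has_commas K).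
Implicit Types A B C D E X Y Q : K.

Lemma cross_deg_id A A' X n (p : fn A A') : cross CC (deg n p) (deg n (sid X)) =
  deg n (cross CC p (sid X)).
Proof. by rewrite deg_cross. Qed.

Lemma pointwise_comma A B D E (k : fn A B) (F : fn A E) (r : fn B E)
    (nu : cell (r ∘ k) F) (b : fn D B) Q (p0 : fn Q D) (p1 : fn Q A) (z : Map Q B 1) :
  is_pointwise_right_kan nu -> is_comma b k p0 p1 z ->
  right_ext p0 (F ∘ p1) (r ∘ b) (wL r (earr z) ⋅ wR (Arrow nu) p1).
Proof.
move=> [_ pw] uz; have [sz tz _] := uz.
have [A2 [q0 [q1 [w uw]]]] := commas (sid B) (sid B).
pose e : edge (b ∘ p0) (k ∘ p1) := exist _ z (conj sz tz).
have /right_extP := pw _ _ _ _ _ _ (comma_square_of_is_comma CC (e := e) uw uz).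
by rewrite arrow_paste_square arrow_edge.
Qed.

(** The square [z × y] is no comma square, but it is obtained from the comma square
    [z × w] over [D × Q] by precomposition with the left adjoint section
    [D × i : D × Y -> D × Q]. *)
Lemma pointwise_cross_comma A B C D E X Y (f : fn B A) (g : fn C A) (p0 : fn D B)
    (p1 : fn D C) (z : Map D A 1) (F : fn (prd CC C X) E) (r : fn (prd CC A X) E)
    (nu : cell (r ∘ cross CC g (sid X)) F) (y : fn Y X) :
  is_pointwise_right_kan nu -> is_comma f g p0 p1 z ->
  right_ext (cross CC p0 (sid Y)) (F ∘ cross CC p1 y) (r ∘ cross CC f y)
    (wL r (earr (cross CC z (deg 1 y))) ⋅ wR (Arrow nu) (cross CC p1 y)).
Proof.
move=> pw uz; have [sz tz _] := uz.
have [Q [q0 [q1 [w uw]]]] := commas y (sid X).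
have [i [th [[i0 i1 iw] [sth tth q0th thi]]]] := is_comma_left_adjoint_section uw.
have sw : vtgt w = q1 by have [_ ->] := uw; rewrite fn1l.
have := pointwise_comma pw (is_comma_cross CC uz uw).
move/right_ext_precomp_left_adjoint => /(_ _ (cross CC (sid D) i)
  (cross CC (sid D) q0) (earr (cross CC (deg 1 (sid D)) th))).
rewrite !cross_comp !fn1r i0 cross_id.
rewrite -scompA cross_comp fn1r i1.
have e1 : atgt (wL r (earr (cross CC z w))) =
    asrc (wR (Arrow nu) (cross CC p1 q1)).
  rewrite !whisker_ends /= /vtgt cross_act -!/(vtgt _) tz sw.
  by rewrite -scompA cross_comp fn1l.
rewrite wR_vc // -wL_wR !wR_wR !wL_earr !wR_earr !deg_cross !cross_comp.
rewrite !wL_earr !fn1r i1 iw q0th thi !scomp1r -!deg_cross; apply=> //.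
- split; first by rewrite /= /vsrc cross_act -!/(vsrc _) vsrc_deg sth.
  by rewrite /= /vtgt cross_act -!/(vtgt _) vtgt_deg tth cross_id.
- by rewrite earr_deg.
- by rewrite earr_deg.
Qed.

(** For [Y = X] and [y] the identity this is the right extension [nu] itself; the
    point is the stability under an arbitrary [y].  Apply [pointwise_cross_comma] to
    the comma [Q] of the identity of [B] and [k], and precompose with the right
    adjoint section [A -> Q]; its composite with the projection to [B] is [k]. *)
Lemma pointwise_cross A B E X Y (k : fn A B) (F : fn (prd CC A X) E)
    (r : fn (prd CC B X) E) (nu : cell (r ∘ cross CC k (sid X)) F) (y : fn Y X) :
  is_pointwise_right_kan nu ->
  right_ext (cross CC k (sid Y)) (F ∘ cross CC (sid A) y) (r ∘ cross CC (sid B) y)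
    (wR (Arrow nu) (cross CC (sid A) y)).
Proof.
move=> pw; have [Q [p0 [p1 [z uz]]]] := commas (sid B) k.
have [i [et [[i1 i0 iz] [set tet p1et eti]]]] := is_comma_right_adjoint_section uz.
have [sz tz _] := uz.
have := pointwise_cross_comma y pw uz.
move/right_ext_precomp_right_adjoint => /(_ _ (cross CC i (sid Y))
  (cross CC p1 (sid Y)) (earr (cross CC et (deg 1 (sid Y))))).
have e1 : atgt (wL r (earr (cross CC z (deg 1 y)))) =
    asrc (wR (Arrow nu) (cross CC p1 y)).
  rewrite !whisker_ends /= /vtgt cross_act -!/(vtgt _) tz vtgt_deg.
  by rewrite -scompA cross_comp fn1l.
rewrite -scompA !cross_comp i1 !fn1r i0.
rewrite wR_vc // -wL_wR !wR_wR -!wL_wL !wL_earr !wR_earr !deg_cross !cross_comp.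
rewrite ?fn1r i1 iz p1et eti !scomp1r -!deg_cross !earr_deg wL_id.
rewrite vc_idl; last by rewrite whisker_ends /= -scompA cross_comp fn1r fn1l.
apply=> //.
- split; first by rewrite /= /vsrc cross_act -!/(vsrc _) vsrc_deg set cross_id.
  by rewrite /= /vtgt cross_act -!/(vtgt _) vtgt_deg tet.
- by rewrite cross_id.
- by rewrite -deg_scomp earr_deg.
Qed.

(** * Transposition *)

Definition untranspose A Y E : sHom (Map Y (expo CC E A)) (Map (prd CC A Y) E).
Proof.
exists (fun n c => deg n (ev CC A E) ∘ cross CC (deg n (sid A)) c) => m n a x.
by rewrite scomp_act cross_act !act_deg.
Defined.

Lemma transposeK A Y E n (t : Map (prd CC A Y) E n) :
  untranspose A Y E n (transpose CC A Y E n t) = t.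
Proof. by rewrite /= -[RHS](ev_curry CC) /cross scomp1l. Qed.

Lemma untransposeK A Y E n (c : Map Y (expo CC E A) n) :
  transpose CC A Y E n (untranspose A Y E n c) = c.
Proof. by rewrite /= -[RHS](curry_ev CC) /cross scomp1l. Qed.

Lemma untranspose_inj A Y E n (c c' : Map Y (expo CC E A) n) :
  untranspose A Y E n c = untranspose A Y E n c' -> c = c'.
Proof. by move=> H; rewrite -(untransposeK c) H untransposeK. Qed.

Lemma untranspose_scomp A Y Z E n (c : Map Y (expo CC E A) n) (y : Map Z Y n) :
  untranspose A Z E n (c ∘ y) = untranspose A Y E n c ∘ cross CC (deg n (sid A)) y.
Proof. by rewrite /= -scompA cross_comp scomp1l. Qed.

Lemma untranspose_expo_map A B E n (u : Map B A n) :
  untranspose B _ E n (expo_map CC E A B n u) =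
  deg n (ev CC A E) ∘ cross CC u (deg n (sid (expo CC E A))).
Proof. exact: transposeK. Qed.

Lemma untranspose_expo A B Y E n (u : Map B A n) (c : Map Y (expo CC E A) n) :
  untranspose B Y E n (expo_map CC E A B n u ∘ c) =
  untranspose A Y E n c ∘ cross CC u (deg n (sid Y)).
Proof.
rewrite untranspose_scomp untranspose_expo_map /= -!scompA !cross_comp.
by rewrite !scomp1l !scomp1r.
Qed.

Lemma expo_map_transpose A B Y E n (u : Map B A n) (t : Map (prd CC A Y) E n) :
  expo_map CC E A B n u ∘ transpose CC A Y E n t =
  transpose CC B Y E n (t ∘ cross CC u (deg n (sid Y))).
Proof. by apply: untranspose_inj; rewrite untranspose_expo !transposeK. Qed.

Lemma transpose_scomp A Y Z E n (t : Map (prd CC A Y) E n) (y : Map Z Y n) :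
  transpose CC A Y E n t ∘ y = transpose CC A Z E n (t ∘ cross CC (deg n (sid A)) y).
Proof. by apply: untranspose_inj; rewrite untranspose_scomp !transposeK. Qed.

Lemma restr_deg A B E n (u : fn B A) :
  deg n (restr CC E u) = expo_map CC E A B n (deg n u).
Proof. by rewrite sfun_deg. Qed.

Lemma curry_cross A B Y E (k : fn B A) (t : fn (prd CC A Y) E) :
  curry CC (t ∘ cross CC k (sid Y)) = restr CC E k ∘ curry CC t.
Proof.
rewrite -[restr _ _ _]deg0 restr_deg -[curry CC t]/(transpose CC A Y E 0 t) expo_map_transpose.
by rewrite !deg0.
Qed.

Lemma transpose_pre_cross A B Y E (k : fn B A) (P : arrow (Map (prd CC A Y) E)) :
  amap (transpose CC B Y E) (wR P (cross CC k (sid Y))) =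
  wL (restr CC E k) (amap (transpose CC A Y E) P).
Proof.
rewrite /wL /wR !amap_comp; apply: amap_ext => n x.
by rewrite -[RHS]/(deg n (restr CC E k) ∘ transpose CC A Y E n x) restr_deg expo_map_transpose
  /= -cross_deg_id.
Qed.

Lemma transpose_wR A Y Z E (y : fn Z Y) (P : arrow (Map (prd CC A Y) E)) :
  amap (transpose CC A Z E) (wR P (cross CC (sid A) y)) = wR (amap (transpose CC A Y E) P) y.
Proof.
rewrite /wR !amap_comp; apply: amap_ext => n x.
by rewrite -[RHS]/(transpose CC A Y E n x ∘ deg n y) transpose_scomp /= -deg_cross.
Qed.

(** Pasting with [z × Y] before transposition is whiskering with [z^*] after it:
    this is where the 2-cell induced by the comma square on exponentials enters. *)
Lemma transpose_wL_cross A D Y E (r : fn (prd CC A Y) E) (z : Map D A 1) :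
  amap (transpose CC D Y E) (wL r (earr (cross CC z (deg 1 (sid Y))))) =
  wR (amap (expo_map CC E A D) (earr z)) (curry CC r).
Proof.
rewrite wL_earr !amap_earr wR_earr; congr earr.
rewrite -[curry CC r]/(transpose CC A Y E 0 r) -sfun_deg expo_map_transpose.
by [].
Qed.

Lemma amap_between (X Y : sSet) (F : sHom X Y) (x y : X 0) (P : arrow X) :
  between x y P -> between (F 0 x) (F 0 y) (amap F P).
Proof. by case=> <- <-. Qed.

Lemma amap_transposeK A Y E (P : arrow (Map (prd CC A Y) E)) :
  amap (untranspose A Y E) (amap (transpose CC A Y E) P) = P.
Proof.
by rewrite amap_comp -[RHS]amap_idmap; apply: amap_ext => n x; apply: transposeK.
Qed.

Lemma amap_untransposeK A Y E (P : arrow (Map Y (expo CC E A))) :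
  amap (transpose CC A Y E) (amap (untranspose A Y E) P) = P.
Proof.
by rewrite amap_comp -[RHS]amap_idmap; apply: amap_ext => n x; apply: untransposeK.
Qed.

(** Transposition is an isomorphism of mapping spaces that carries precomposition
    with [k × Y] to postcomposition with [k^*]. *)
Lemma right_lift_of_ext A B Y E (k : fn A B) (F : fn (prd CC A Y) E)
    (r : fn (prd CC B Y) E) M :
  right_ext (cross CC k (sid Y)) F r M ->
  right_lift (restr CC E k) (curry CC F) (curry CC r) (amap (transpose CC A Y E) M).
Proof.
move=> [bM uM].
split.
  have := amap_between (transpose CC A Y E) bM.
  by rewrite /= curry_cross.
move=> e al bal.
have eE : curry CC (untranspose B Y E 0 e) = e by apply: untransposeK.
have [|be [[bb E1] ub]] := uM (untranspose B Y E 0 e) (amap (untranspose A Y E) al).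
  have := amap_between (untranspose A Y E) bal.
  rewrite -{1}eE -curry_cross.
  by rewrite (transposeK (untranspose B Y E 0 e ∘ cross CC k (sid Y))) (transposeK F).
exists (amap (transpose CC B Y E) be); split.
  split; first by have := amap_between (transpose CC B Y E) bb; rewrite untransposeK.
  rewrite -transpose_pre_cross -amap_vc ?E1 ?amap_untransposeK //.
  by case: bb bM => _ tb [sM _]; rewrite whisker_ends tb sM.
move=> be' [bb' E1'].
rewrite (ub (amap (untranspose B Y E) be')) ?amap_untransposeK //; split.
  by have := amap_between (untranspose B Y E) bb'; rewrite (transposeK r).
rewrite -E1' -[LHS]amap_transposeK; congr amap.
rewrite amap_vc ?transpose_pre_cross ?amap_untransposeK //.
case: bb' bM => _ tb [sM _]; rewrite whisker_ends /= tb sM.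
by congr (_ ∘ _); apply: transposeK.
Qed.

End Pointwise.

(** * Comma objects in a cosmos *)

(** The boundary of [Delta 1]. *)
Definition two_points : sSet.
Proof. by exists (fun _ => bool) (fun _ _ _ b => b). Defined.

Definition vertex_of (b : bool) : 'I_2 := if b then ord_max else ord0.

Definition two_points_incl : sHom two_points (Delta 1).
Proof.
exists (fun n (b : bool) => mono_const n (vertex_of b)) => m n a b /=.
by rewrite mono_const_comp.
Defined.

Lemma two_points_incl_inj : injective_shom two_points_incl.
Proof.
move=> n b b' /= E; have := congr1 (fun u : mono n 1 => val (u ord0)) E.
by rewrite /= !ffunE /=; case: b E; case: b'.
Qed.

Lemma two_points_fp : finitely_presented two_points.
Proof.
exists [:: existT _ 0 true; existT _ 0 false] => -[|n] x nd.
  by case: x nd => _; [left|right; left].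
case: nd; exists 0, (mono_const n.+1 ord0), x; split=> // j.
by exists ord0; rewrite [j]ord1 mk_monoE.
Qed.

(** A simplex of [Delta 1] is constant, hence a degeneracy of a vertex, or
    surjective, hence a degeneracy of [D1_edge]. *)
Lemma Delta1_fp : finitely_presented (Delta 1).
Proof.
exists [:: existT _ 0 (mono_const 0 ord0); existT _ 0 (mono_const 0 ord_max);
           existT _ 1 (mono_id 1)] => n u nd.
have V (i : 'I_2) : i = ord0 \/ i = ord_max.
  by case: i => [[|[|]]] // p; [left|right]; apply: val_inj.
have C i : u = mono_const n i -> n = 0.
  case: n u nd => // n u nd uE; case: nd.
  exists 0, (mono_const n.+1 ord0), (mono_const 0 i); split=> //.
    by move=> j; exists ord0; rewrite [j]ord1 mk_monoE.
  by rewrite /= mono_const_comp.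
have C' i : u = mono_const n i -> List.In (existT _ n u)
    [:: existT _ 0 (mono_const 0 ord0); existT _ 0 (mono_const 0 ord_max);
           existT (fun n => Delta 1 n) 1 (mono_id 1)].
  move=> uE; have n0 := C i uE; subst n; rewrite uE.
  by have [->|->] := V i; [left|right; left].
have [u0|u0] := V (u ord0); last first.
  apply: (C' ord_max); apply: mono_ext => j; rewrite mk_monoE; apply: val_inj.
  by have := mono_le u (leq0n j : ord0 <= j); rewrite u0 /=;
    have := ltn_ord (u j); lia.
have [u1|u1] := V (u ord_max).
  apply: (C' ord0); apply: mono_ext => j; rewrite mk_monoE; apply: val_inj.
  by have := mono_le u (leq_ord j : j <= (ord_max : 'I_n.+1)); rewrite u1 /=; lia.
have [n1|n1] := boolP (1 < n).
  case: nd; exists 1, u, (mono_id 1); split=> //; last by rewrite /= mono_1comp.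
  by move=> j; have [->|->] := V j; [exists ord0|exists ord_max].
right; right; left.
case: n u nd {C C'} u0 u1 n1 => [|[|]] // u nd u0 u1 _.
  by move: u0; rewrite (_ : ord0 = ord_max) ?u1 //; apply: val_inj.
congr (existT _ _ _); apply: mono_ext => j.
by have [->|->] := V j; rewrite ?u0 ?u1 mk_monoE.
Qed.

Section Cosmos.
Variables (K : cosmos) (CC : cartesian_closed K).
Implicit Types A B C D X Y T : K.

Lemma terminal_eq T X n (x y : Map X T n) : is_terminal T -> x = y.
Proof. by move=> H; apply: (exists_unique_inj (H X n)). Qed.

Lemma terminal_cotensor T (U : sSet) (cone : sHom U (Map T T)) :
  is_terminal T -> is_cotensor cone.
Proof.
move=> HT X n t; have [c _] := HT X n; exists c; split=> [m u a|c' _].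
  exact: terminal_eq.
exact: terminal_eq.
Qed.

Definition terminal_cone T (U : sSet) : sHom U (Map T T).
Proof. by exists (fun n _ => deg n (sid T)) => m n a x; rewrite act_deg. Defined.

Definition square_cone A : sHom two_points (Map (prd CC A A) A).
Proof.
exists (fun n (b : bool) => deg n (if b then fst1 CC A A else snd1 CC A A)).
by move=> m n a b; rewrite act_deg.
Defined.

Lemma square_cotensor A : is_cotensor (square_cone A).
Proof.
move=> X n t; exists (pairing CC (t n (true, mono_id n)) (t n (false, mono_id n))).
split=> [m b a|c Hc].
  rewrite pair_act; case: b; rewrite /= ?fst_pairing ?snd_pairing -sfun_act /=;
    by rewrite mono_1comp.
by apply: pair_ext; rewrite ?fst_pairing ?snd_pairing Hc act_id.
Qed.

(** The axiom on Leibniz cotensors for the map from [A] to the terminal object and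
    the inclusion of the boundary of [Delta 1]: as the cotensors of the terminal
    object are terminal, the pullback in the axiom is [A × A]. *)
Lemma ends_isofib A A2 (cone : sHom (Delta 1) (Map A2 A)) : is_cotensor cone ->
  isofib (pairing CC (cone 0 (D1_vertex ord_max)) (cone 0 (D1_vertex ord0))).
Proof.
move=> ct; have ax := cosmos_axioms K.
have [T HT] := has_terminal ax.
have [pA _] := HT A 0; have [pA2 _] := HT A2 0; have [pP _] := HT (prd CC A A) 0.
have coneV l (i : 'I_2) : cone l (mono_const l i) = deg l (cone 0 (D1_vertex i)).
  rewrite /deg -sfun_act /= /D1_vertex; congr (cone l _).
  by rewrite mono_const_comp.
apply: (@isofib_leibniz _ _ ax A T pA two_points (Delta 1) two_points_incl
  A2 (prd CC A A) T T cone (square_cone A) (terminal_cone T (Delta 1))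
  (terminal_cone T two_points) pP (sid T)
  (pairing CC (cone 0 (D1_vertex ord_max)) (cone 0 (D1_vertex ord0)))
  pA2 (prd CC A A) (sid _) pP).
- exact: isofib_terminal ax _ _ _ HT.
- exact: two_points_fp.
- exact: Delta1_fp.
- exact: two_points_incl_inj.
- exact: ct.
- exact: square_cotensor.
- exact: terminal_cotensor.
- exact: terminal_cotensor.
- by move=> n u; apply: terminal_eq.
- by move=> n u; apply: terminal_eq.
- move=> n b; rewrite /= scomp1l coneV -deg_scomp.
  by case: b; rewrite ?fst_pairing0 ?snd_pairing0.
- by move=> n u; apply: terminal_eq.
- split; first exact: terminal_eq.
  move=> X n a b _; exists a; split; first by rewrite scomp1l; split=> //; apply: terminal_eq.
  by move=> c [<- _]; rewrite scomp1l.
- exact: fn1l.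
- exact: terminal_eq.
Qed.

Lemma cosmos_has_commas : has_commas K.
Proof.
move=> A B C f g; have ax := cosmos_axioms K.
have [A2 [cone ct]] := has_cotensors ax A Delta1_fp.
pose ends := pairing CC (cone 0 (D1_vertex ord_max)) (cone 0 (D1_vertex ord0)).
have [D [m [q pb]]] := has_isofib_pullbacks ax (cross CC g f) (ends_isofib ct).
have sq : ends ∘ m = cross CC g f ∘ q by case: pb.
have E1 : cone 0 (D1_vertex ord_max) ∘ m = g ∘ (fst1 CC C B ∘ q).
  rewrite -[X in X ∘ m](fst_pairing0 CC _ (cone 0 (D1_vertex ord0))) -scompA -/ends sq.
  by rewrite !scompA; congr (_ ∘ _); have := @fst_cross _ CC _ _ _ _ 0 g f; rewrite !deg0.
have E0 : cone 0 (D1_vertex ord0) ∘ m = f ∘ (snd1 CC C B ∘ q).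
  rewrite -[X in X ∘ m](snd_pairing0 CC (cone 0 (D1_vertex ord_max))) -scompA -/ends sq.
  by rewrite !scompA; congr (_ ∘ _); have := @snd_cross _ CC _ _ _ _ 0 g f; rewrite !deg0.
have se : vsrc (cone 1 D1_edge ∘ deg 1 m) = f ∘ (snd1 CC C B ∘ q).
  rewrite vsrc_scomp vsrc_deg -E0 /vsrc -sfun_act /=; congr (cone 0 _ ∘ _).
  by rewrite mono_1comp -[coface _]mono_comp1 coface_max_comp.
have te : vtgt (cone 1 D1_edge ∘ deg 1 m) = g ∘ (fst1 CC C B ∘ q).
  rewrite vtgt_scomp vtgt_deg -E1 /vtgt -sfun_act /=; congr (cone 0 _ ∘ _).
  by rewrite mono_1comp -[coface _]mono_comp1 coface0_comp.
pose e : edge (f ∘ (snd1 CC C B ∘ q)) (g ∘ (fst1 CC C B ∘ q)) :=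
  exist _ _ (conj se te).
have sqr : comma_square (hpi (wedge e)).
  exists A2, cone, (prd CC A A), (fst1 CC A A), (snd1 CC A A), (prd CC C B),
    (fst1 CC C B), (snd1 CC C B), ends, (cross CC g f), m, q, e.
  split; split=> //; try exact: prd_is_product.
    by rewrite fst_pairing0 snd_pairing0.
  by have := (@fst_cross _ CC _ _ _ _ 0 g f, @snd_cross _ CC _ _ _ _ 0 g f); rewrite !deg0 => -[].
have [e' _ up] := is_comma_of_square sqr.
by exists D, (snd1 CC C B ∘ q), (fst1 CC C B ∘ q), (sval e').
Qed.
End Cosmos.

Section Core.
Variables (K : sCat) (CC : cartesian_closed K) (commas : has_commas K).
Implicit Types A B C D E X Y : K.

(** * The Beck-Chevalley isomorphism *)

(** [kX] stands for [k × E^A]; keeping it a variable lets the same lemmas apply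
    in the dual, where the product of functors is equal but not convertible to the
    original one. *)
Definition transpose_cell A B E (r : fn (prd CC A (expo CC E B)) E)
    (kX : fn (prd CC B (expo CC E B)) (prd CC A (expo CC E B)))
    (nu : cell (r ∘ kX) (ev CC B E)) :=
  amap (transpose CC B (expo CC E B) E) (Arrow nu).

Lemma curry_scomp A Y Z E (t : fn (prd CC A Y) E) (y : fn Z Y) :
  curry CC (t ∘ cross CC (sid A) y) = curry CC t ∘ y.
Proof. by rewrite -[curry CC t]/(transpose CC A Y E 0 t) transpose_scomp !deg0. Qed.

(** The counit of [k^* ⊣ ran_k] is an absolute right lifting: its restriction along
    every [y] is a right lifting of [y]. *)
Lemma counit_right_lift A B E (k : fn A B) (r : fn (prd CC B (expo CC E A)) E)
    kX (nu : cell (r ∘ kX) (ev CC A E)) Y (y : fn Y (expo CC E A)) :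
  kX = cross CC k (sid _) -> is_pointwise_right_kan nu ->
  right_lift (restr CC E k) y (curry CC r ∘ y) (wR (transpose_cell nu) y).
Proof.
move=> kXE pw; subst kX.
have := right_lift_of_ext (pointwise_cross commas y pw).
by rewrite !curry_scomp curry_evaluation fn1l transpose_wR.
Qed.

Lemma counit_between A B E (k : fn A B) (r : fn (prd CC B (expo CC E A)) E)
    kX (nu : cell (r ∘ kX) (ev CC A E)) : kX = cross CC k (sid _) ->
  between (restr CC E k ∘ curry CC r) (sid _) (transpose_cell nu).
Proof.
move=> kXE; subst kX; split; first exact: curry_cross.
exact: curry_evaluation.
Qed.

(** The statement on right extensions, in any simplicial category with comma
    objects so that it applies to the dual as well. *)
Theorem ran_beck_chevalley A B C D E (f : fn B A) (g : fn C A) (h : fn D B)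
    (k : fn D C) (z : Map D A 1)
    (rg : fn (prd CC A (expo CC E C)) E) gX (nug : cell (rg ∘ gX) (ev CC C E))
    (rh : fn (prd CC B (expo CC E D)) E) hX (nuh : cell (rh ∘ hX) (ev CC D E)) :
  gX = cross CC g (sid _) -> hX = cross CC h (sid _) ->
  is_comma f g h k z -> is_pointwise_right_kan nug -> is_pointwise_right_kan nuh ->
  (exists eta, adjunction (restr CC E h) (curry CC rh) eta (transpose_cell nuh)) /\
  forall eta, adjunction (restr CC E h) (curry CC rh) eta (transpose_cell nuh) ->
    invertible (rmate (restr CC E f) (restr CC E k) (curry CC rg) (curry CC rh)
      (amap (expo_map CC E A D) (earr z)) eta (transpose_cell nug)).
Proof.
move=> gXE hXE uz pwg pwh; have bh := counit_between nuh hXE.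
have bg := counit_between nug gXE.
split.
  apply: adjunction_of_right_lift bh _ _; first exact: counit_right_lift.
  by have := counit_right_lift (sid _) hXE pwh; rewrite fn1r wR1.
move=> eta adj.
have [sz tz _] := uz.
have bs : between (restr CC E h ∘ restr CC E f) (restr CC E k ∘ restr CC E g)
    (amap (expo_map CC E A D) (earr z)).
  by split; rewrite -restr_comp /= ?sz ?tz.
apply: (rmate_invertible bs bg adj); last exact: counit_right_lift.
subst gX.
have := right_lift_of_ext (pointwise_cross_comma commas (sid _) pwg uz).
rewrite amap_vc; last first.
  rewrite !whisker_ends /= /vtgt cross_act -!/(vtgt _) tz vtgt_deg.
  by rewrite -scompA cross_comp fn1l.
rewrite transpose_wL_cross transpose_pre_cross.
by rewrite !curry_cross curry_evaluation fn1r.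
Qed.
End Core.

Section Duality.
Variable K : sCat.
Implicit Types A B C D X Y XA XB XC XD : K.

(** * Passage to the dual *)

Lemma aop_inj (X : sSet) (P Q : arrow X) : aop P = aop Q -> P = Q.
Proof. by move=> E; rewrite -[P]aopK E aopK. Qed.

Lemma between_aop (X : sSet) (x y : X 0) (P : arrow X) :
  between x y P <-> @between (sop X) y x (aop P).
Proof. by split=> -[]. Qed.

Lemma aop_wL X A B (b : fn A B) (P : arrow (Map X A)) :
  aop (wL b P) = @wL (co K) X A B b (aop P).
Proof.
rewrite /wL aop_amap; apply: amap_ext => n x.
congr (@scomp K X A B n _ x); exact: esym (deg_op n b).
Qed.

Lemma aop_wR A B Y (P : arrow (Map B Y)) (a : fn A B) :
  aop (wR P a) = @wR (co K) A B Y (aop P) a.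
Proof.
rewrite /wR aop_amap; apply: amap_ext => n x.
congr (@scomp K A B Y n x _); exact: esym (deg_op n a).
Qed.

Lemma invertible_aop (X : sSet) (P : arrow X) : invertible (aop P) -> invertible P.
Proof.
case=> Q [bQ E1 E2]; exists (aunop Q); split.
- by apply/between_aop; rewrite aunopK.
- by apply: aop_inj; rewrite aop_vc ?aunopK ?aop_id //; case: bQ.
- by apply: aop_inj; rewrite aop_vc ?aunopK ?aop_id //; case: bQ.
Qed.

(** Duality reverses 2-cells but not functors, so it exchanges the two adjoints
    and turns the counit into the unit. *)
Lemma adjunction_aop X Y (l : fn X Y) (r : fn Y X) eta eps :
  adjunction l r eta eps <-> @adjunction (co K) Y X r l (aop eps) (aop eta).
Proof.
have E1 : between (sid X) (r ∘ l) eta -> between (l ∘ r) (sid Y) eps ->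
    aop (wL l eta ⋅ wR eps l) =
    @wR (co K) _ _ _ (aop eps) l ⋅ @wL (co K) _ _ _ l (aop eta).
  move=> [_ tT] [sE _]; rewrite aop_vc ?aop_wL ?aop_wR //.
  by rewrite !whisker_ends tT sE scompA.
have E2 : between (sid X) (r ∘ l) eta -> between (l ∘ r) (sid Y) eps ->
    aop (wR eta r ⋅ wL r eps) =
    @wL (co K) _ _ _ r (aop eps) ⋅ @wR (co K) _ _ _ (aop eta) r.
  move=> [_ tT] [sE _]; rewrite aop_vc ?aop_wL ?aop_wR //.
  by rewrite !whisker_ends tT sE scompA.
split=> [[bT bE T1 T2]|[/between_aop bE /between_aop bT T1 T2]].
  split; [exact/between_aop|exact/between_aop| |].
    by rewrite -E2 // T2 aop_id.
  by rewrite -E1 // T1 aop_id.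
split=> //; apply: aop_inj; rewrite aop_id.
  by rewrite E1.
by rewrite E2.
Qed.

Lemma aop_lmate XA XB XC XD (F : fn XA XB) (H : fn XB XD) (G : fn XA XC)
    (M : fn XC XD) (Lf : fn XB XA) (Lk : fn XD XC) (s : arrow (Map XA XD))
    (eta : arrow (Map XB XB)) (eps : arrow (Map XC XC)) :
  between (H ∘ F) (M ∘ G) s -> between (sid XB) (F ∘ Lf) eta ->
  between (Lk ∘ M) (sid XC) eps ->
  aop (lmate H G Lf Lk s eta eps) =
  @rmate (co K) _ _ _ _ G H Lf Lk (aop s) (aop eps) (aop eta).
Proof.
move=> [ss ts] [sT tT] [sE tE].
have e1 : atgt (wL (Lk ∘ H) eta) = asrc (wL Lk (wR s Lf)).
  by rewrite !whisker_ends tT ss !scompA.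
have e2 : atgt (wL Lk (wR s Lf)) = asrc (wR eps (G ∘ Lf)).
  by rewrite !whisker_ends ts sE !scompA.
rewrite /lmate -vcA // /rmate aop_vc ?asrc_vc // aop_vc //.
by rewrite -wL_wL !(aop_wL, aop_wR).
Qed.
End Duality.

Section DualClosed.
Variables (K : sCat) (CC : cartesian_closed K).

Definition co_closed : cartesian_closed (co K).
Proof.
apply: (@CartesianClosed (co K) (prd CC) (fst1 CC) (snd1 CC)
  (fun X A B n => @pairing K CC X A B n) _ _ _ (expo CC) (ev CC)
  (fun A X C n => @curry K CC A X C n)).
- move=> X A B n a b; rewrite (@deg_op (Map _ _)); exact: (fst_pairing CC a b).
- move=> X A B n a b; rewrite (@deg_op (Map _ _)); exact: (snd_pairing CC a b).
- move=> X A B n c; rewrite !(@deg_op (Map _ _)); exact: (pair_eta CC c).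
- move=> A X C n t; rewrite !(@deg_op (Map _ _)); exact: (ev_curry CC t).
- move=> A X C n c; rewrite !(@deg_op (Map _ _)); exact: (curry_ev CC c).
Defined.

Lemma co_crossE (A A' B B' : K) n (x : Map A A' n) (y : Map B B' n) :
  @cross (co K) co_closed A A' B B' n x y = cross CC x y.
Proof.
congr (@pairing K CC _ A' B' n (@scomp K _ _ _ n x _) (@scomp K _ _ _ n y _));
  exact: deg_op.
Qed.

Lemma co_expo_mapE (E A B : K) n (u : Map B A n) :
  expo_map co_closed E A B n u = expo_map CC E A B n u.
Proof.
congr (@curry K CC _ _ _ n (@scomp K _ _ _ n _ _)); first exact: deg_op.
by rewrite co_crossE (deg_op n (sid (expo CC E A))).
Qed.

Lemma co_restrE (E A B : K) (u : fn B A) : restr co_closed E u = restr CC E u.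
Proof. exact: co_expo_mapE. Qed.

Lemma aop_transpose (A Y E : K) (P : arrow (Map (prd CC A Y) E)) :
  aop (amap (transpose CC A Y E) P) = amap (transpose co_closed A Y E) (aop P).
Proof. by rewrite aop_amap; apply: amap_ext. Qed.

Lemma aop_expo_map (E A B : K) (P : arrow (Map B A)) :
  aop (amap (expo_map CC E A B) P) = amap (expo_map co_closed E A B) (aop P).
Proof. by rewrite aop_amap; apply: amap_ext => n x; rewrite co_expo_mapE. Qed.
End DualClosed.

Lemma arrow_ran_counit (K : sCat) (CC : cartesian_closed K) (E A B : K)
    (k : fn A B) (r : fn (prd CC B (expo CC E A)) E)
    (nu : cell (r ∘ times_expo CC E k) (ev CC A E)) :
  Arrow (ran_counit nu) = transpose_cell nu.
Proof. by rewrite /ran_counit arrow_cell_cast. Qed.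

Lemma arrow_lan_unit (K : sCat) (CC : cartesian_closed K) (E A B : K)
    (k : fn A B) (l : fn (prd CC B (expo CC E A)) E)
    (nu : cell (ev CC A E) (l ∘ times_expo CC E k)) :
  Arrow (lan_unit nu) = amap (transpose CC A (expo CC E A) E) (Arrow nu).
Proof. by rewrite /lan_unit arrow_cell_cast. Qed.

Lemma arrow_restr_square (K : sCat) (CC : cartesian_closed K) (E A B C D : K)
    (f : fn B A) (g : fn C A) (h : fn D B) (k : fn D C)
    (la : cell (f ∘ h) (g ∘ k)) :
  Arrow (restr_square CC E la) = amap (expo_map CC E A D) (Arrow la).
Proof. by rewrite /restr_square arrow_cell_cast. Qed.

Theorem proposition5p3p9 (K : cosmos) (CC : cartesian_closed K)
    (A B C D E : K) (f : fn B A) (g : fn C A) (h : fn D B) (k : fn D C)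
    (lambda : cell (f ∘ h) (g ∘ k)) (Hlambda : comma_square lambda) :
  (forall (rg : fn (prd CC A (expo CC E C)) E)
          (nug : cell (rg ∘ times_expo CC E g) (ev CC C E))
          (rh : fn (prd CC B (expo CC E D)) E)
          (nuh : cell (rh ∘ times_expo CC E h) (ev CC D E)),
    functorial_pointwise_ran nug -> functorial_pointwise_ran nuh ->
    (exists eta : cell (sid (expo CC E B)) (curry CC rh ∘ restr CC E h),
       is_adjunction eta (ran_counit nuh)) /\
    (forall eta : cell (sid (expo CC E B)) (curry CC rh ∘ restr CC E h),
       is_adjunction eta (ran_counit nuh) ->
       is_iso2 (mate_right (restr_square CC E lambda) eta (ran_counit nug)
                : cell (restr CC E f ∘ curry CC rg) (curry CC rh ∘ restr CC E k)))) /\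
  (forall (lf : fn (prd CC A (expo CC E B)) E)
          (nuf : cell (ev CC B E) (lf ∘ times_expo CC E f))
          (lk : fn (prd CC C (expo CC E D)) E)
          (nuk : cell (ev CC D E) (lk ∘ times_expo CC E k)),
    functorial_pointwise_lan nuf -> functorial_pointwise_lan nuk ->
    (exists eps : cell (curry CC lk ∘ restr CC E k) (sid (expo CC E C)),
       is_adjunction (lan_unit nuk) eps) /\
    (forall eps : cell (curry CC lk ∘ restr CC E k) (sid (expo CC E C)),
       is_adjunction (lan_unit nuk) eps ->
       is_iso2 (mate_left (restr_square CC E lambda) (lan_unit nuf) eps
                : cell (curry CC lk ∘ restr CC E h) (restr CC E g ∘ curry CC lf)))).
Proof.
have commas := cosmos_has_commas CC.
have [e lE uz] := is_comma_of_square Hlambda.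
have lA : Arrow lambda = earr (sval e) by rewrite lE arrow_edge.
split.
  move=> rg nug rh nuh pwg pwh.
  have [[eta0 adj0] mate] := ran_beck_chevalley commas erefl erefl uz pwg pwh.
  split.
    have [/between_arrow [eta etaE] _ _ _] := adj0.
    by exists eta; apply/is_adjunctionP; rewrite arrow_ran_counit -etaE.
  move=> eta /is_adjunctionP; rewrite arrow_ran_counit => /mate inv.
  by apply/is_iso2P; rewrite arrow_mate_right arrow_restr_square lA !arrow_ran_counit.
(* The left half is the right half in the dual, where [D] is the comma of [g]
   and [f] and the projections [h] and [k] change places. *)
move=> lf nuf lk nuk pwf pwk.
have fX : times_expo CC E f = @cross (co K) (co_closed CC) _ _ _ _ 0 f (sid _).
  by rewrite co_crossE.
have kX : times_expo CC E k = @cross (co K) (co_closed CC) _ _ _ _ 0 k (sid _).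
  by rewrite co_crossE.
have [] := @ran_beck_chevalley (co K) (co_closed CC) (has_commas_co commas) A C B D E
  g f k h (sval e) lf _ (cell_co nuf) lk _ (cell_co nuk) fX kX (is_comma_co uz) pwf pwk.
rewrite !co_restrE.
have tE (X Y : K) (u : fn X Y) (l : fn (prd CC Y (expo CC E X)) E)
    (nu : cell (ev CC X E) (l ∘ times_expo CC E u)) :
    @transpose_cell (co K) (co_closed CC) _ _ _ l _ (cell_co nu) = aop (Arrow (lan_unit nu)).
  by rewrite arrow_lan_unit aop_transpose.
have adjK := @adjunction_aop K _ _ (curry CC lk : fn (expo CC E D) (expo CC E C))
  (restr CC E k).
rewrite !tE -aop_earr -aop_expo_map -lA -arrow_restr_square => -[eta0 adj0] mate.
split.
  rewrite -[eta0]aunopK in adj0; have {}adj0 := proj2 (adjK _ _) adj0.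
  have [_ /between_arrow [eps epsE] _ _] := adj0.
  by exists eps; apply/is_adjunctionP; rewrite -epsE.
move=> eps /is_adjunctionP /adjK /mate inv.
apply/is_iso2P; rewrite arrow_mate_left; apply: invertible_aop.
by rewrite (aop_lmate (F := restr CC E f) (M := restr CC E k)).
Qed.
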